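(* Let $\mathbb{K}$ be a field, $S=\mathbb{K}[x_1,\dots,x_n]$, and for $i=1,2$ let $I_i=\mathcal{B}(M_i,N_i)$ with $M_i=x_{a_i}x_{b_i}$, $N_i=x_{c_i}x_{d_i}$, $1\le c_i<a_i\le b_i<d_i\le n$, and assume $d_1\le d_2$. Let $\mathcal{G}=\mathcal{G}_1\cup\mathcal{G}_2\cup\mathcal{G}_3$ where $$\mathcal{G}_1=\{\underline{T_uT_v}-T_{u'}T_{v'}:uv=u'v'\text{ and }u,v\succ_{rlex}v'\},$$ $$\mathcal{G}_2=\{\underline{Z_uZ_v}-Z_{u'}Z_{v'}:uv=u'v'\text{ and }u,v\succ_{mrlex}v'\},$$ $$\mathcal{G}_3=\{\underline{T_uZ_v}-T_{u'}Z_{v'}:uv=u'v'\text{ and }v\succ_{mrlex}v'\}.$$ Then $\mathcal{G}$ is a Gröbner basis of the toric ideal $T(I_1\oplus I_2)$ with respect to the head and tail order $\succ_{ht}$ on $R$.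
   Context: A monomial ideal is strongly stable if for each monomial $m$ in it, $x_j\frac{m}{x_i}$ is in it whenever $x_i\mid m$ and $j<i$; $\mathcal{B}(m_1,\dots,m_k)$ is the smallest strongly stable ideal containing $m_1,\dots,m_k$. For $i=1,2$, $\mathcal{B}_{M_i}$ is the set of minimal monomial generators of $\mathcal{B}(M_i)$ and $\mathcal{B}_{N_i}$ is the set of minimal monomial generators of $I_i$ not lying in $\mathcal{B}(M_i)$. Let $R=\mathbb{K}[T_u,Z_v:u\in\mathcal{B}_{M_1}\cup\mathcal{B}_{N_1},\ v\in\mathcal{B}_{M_2}\cup\mathcal{B}_{N_2}]$; in the definition of $\mathcal{G}$, indices of $T$-variables range over $\mathcal{B}_{M_1}\cup\mathcal{B}_{N_1}$ and indices of $Z$-variables over $\mathcal{B}_{M_2}\cup\mathcal{B}_{N_2}$. The toric ideal $T(I_1\oplus I_2)$ is the kernel of the $\mathbb{K}$-algebra map $\varphi':R\to S[t,z]$, $T_u\mapsto ut$, $Z_v\mapsto vz$. Here $\succ_{rlex}$ is the graded reverse lexicographic order on $S$ with $x_1>\dots>x_n$. For $m,m'\in\mathcal{B}_{M_2}\cup\mathcal{B}_{N_2}$, $m\succ_{mrlex}m'$ means: (i) $m,m'\in\mathcal{B}_{M_2}$ and $m\succ_{rlex}m'$; or (ii) $m\in\mathcal{B}_{N_2}$ and $m'\in\mathcal{B}_{M_2}$; or (iii) $m,m'\in\mathcal{B}_{N_2}$ and $m\succ_{rlex}m'$. The variables of $R$ are ordered by: $T_u>_{ht}T_v$ if $u\succ_{rlex}v$;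 $T_u>_{ht}Z_v$ for all $u,v$; $Z_u>_{ht}Z_v$ if $u\succ_{mrlex}v$. The head and tail order $\succ_{ht}$ is the (graded) reverse lexicographic order on $R$ induced by $>_{ht}$. Underlined terms are the initial terms. *)

(* Defs.v *)
From HB Require Import structures.
From mathcomp Require Import all_boot all_order all_algebra.
From mathcomp Require Import finmap.
From mathcomp Require Import boolp classical_sets cardinality.
From mathcomp.multinomials Require Export monalg.

Set Implicit Arguments.
Unset Strict Implicit.
Unset Printing Implicit Defensive.

Import GRing.Theory.

Local Open Scope classical_set_scope.
Local Open Scope ring_scope.

(* The polynomial ring over [K] with variables indexed by [I] is
   [{malg K[{cmonom I}]}]; its monomials are the elements [<< m >>]. *)

Definition is_ideal (A : comNzRingType) (J : set A) : Prop :=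
  [/\ J 0, forall f g, J f -> J g -> J (f + g) & forall r f, J f -> J (r * f)].

Definition ideal_gen (A : comNzRingType) (G : set A) : set A :=
  [set f | forall J : set A, is_ideal J -> G `<=` J -> J f].

(* Graded reverse lexicographic order, as a strict order: [degrevlex gtv m m']
   reads "m is larger than m'".  [gtv i j] reads "the variable i is larger than
   the variable j", so [i] below is the smallest variable whose exponents in
   [m] and [m'] differ. *)
Definition degrevlex (I : choiceType) (gtv : I -> I -> Prop)
    (m m' : {cmonom I}) : Prop :=
  (mdeg m' < mdeg m)%N \/
  mdeg m = mdeg m' /\
  exists i : I, (m i < m' i)%N /\ (forall j : I, gtv i j -> m j = m' j).

Definition is_initial (K : fieldType) (I : choiceType)
    (gt : {cmonom I} -> {cmonom I} -> Prop)
    (f : {malg K[{cmonom I}]}) (m : {cmonom I}) : Prop :=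
  m \in msupp f /\ (forall m', m' \in msupp f -> m' != m -> gt m m').

Definition initial_terms (K : fieldType) (I : choiceType)
    (gt : {cmonom I} -> {cmonom I} -> Prop)
    (A : set {malg K[{cmonom I}]}) : set {malg K[{cmonom I}]} :=
  [set h | exists f m,
     [/\ A f, is_initial gt f m & h = << mcoeff m f *g m >>]].

Definition initial_ideal (K : fieldType) (I : choiceType)
    (gt : {cmonom I} -> {cmonom I} -> Prop)
    (A : set {malg K[{cmonom I}]}) : set {malg K[{cmonom I}]} :=
  ideal_gen (initial_terms gt A).

Definition groebner_basis (K : fieldType) (I : choiceType)
    (gt : {cmonom I} -> {cmonom I} -> Prop)
    (G J : set {malg K[{cmonom I}]}) : Prop :=
  [/\ finite_set G, G `<=` J & ideal_gen (initial_terms gt G) = initial_ideal gt J].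

Definition monomial_ideal (K : fieldType) (n : nat)
    (J : set {malg K[{cmonom 'I_n}]}) : Prop :=
  exists A : set {cmonom 'I_n}, J = ideal_gen [set << m >> | m in A].

Definition strongly_stable (K : fieldType) (n : nat)
    (J : set {malg K[{cmonom 'I_n}]}) : Prop :=
  monomial_ideal J /\
  (forall (m : {cmonom 'I_n}) (i j : 'I_n),
     J << m >> -> (0 < m i)%N -> (j < i)%N ->
     J << divcm (mmul (ucm j) m) (ucm i) >>).

Definition borel (K : fieldType) (n : nat) (ms : seq {cmonom 'I_n}) :
    set {malg K[{cmonom 'I_n}]} :=
  [set f | forall J, strongly_stable J ->
     (forall m, m \in ms -> J << m >>) -> J f].

Arguments borel K {n} ms _.

Definition min_gens (K : fieldType) (n : nat)
    (J : set {malg K[{cmonom 'I_n}]}) : set {cmonom 'I_n} :=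
  [set m | J << m >> /\ (forall p q, m = mmul p q -> J << p >> -> p = m)].

Definition BM (K : fieldType) (n : nat) (M : {cmonom 'I_n}) :
    set {cmonom 'I_n} :=
  min_gens (borel K [:: M]).

Definition BN (K : fieldType) (n : nat) (M N : {cmonom 'I_n}) :
    set {cmonom 'I_n} :=
  [set m | min_gens (borel K [:: M; N]) m /\ ~ borel K [:: M] << m >>].

Definition gens (K : fieldType) (n : nat) (M N : {cmonom 'I_n}) : choiceType :=
  {u : {cmonom 'I_n} | `[< (BM K M `|` BN K M N) u >]}.

Definition gval (K : fieldType) (n : nat) (M N : {cmonom 'I_n})
  (u : gens K M N) : {cmonom 'I_n} := val u.

Definition rlex (n : nat) : {cmonom 'I_n} -> {cmonom 'I_n} -> Prop :=
  degrevlex (fun i j : 'I_n => (i < j)%N).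

Definition mrlex (K : fieldType) (n : nat) (M N : {cmonom 'I_n})
    (m m' : gens K M N) : Prop :=
  [\/ [/\ BM K M (gval m), BM K M (gval m') & rlex (gval m) (gval m')],
      BN K M N (gval m) /\ BM K M (gval m') |
      [/\ BN K M N (gval m), BN K M N (gval m') & rlex (gval m) (gval m')]].

(* The index set of the variables of R: [inl u] stands for T_u and [inr v] for
   Z_v. *)
Definition vars (K : fieldType) (n : nat) (M1 N1 M2 N2 : {cmonom 'I_n}) :
    choiceType :=
  (gens K M1 N1 + gens K M2 N2)%type.

Definition gt_var (K : fieldType) (n : nat) (M1 N1 M2 N2 : {cmonom 'I_n})
    (w w' : vars K M1 N1 M2 N2) : Prop :=
  match w, w' with
  | inl u, inl v => rlex (gval u) (gval v)
  | inl _, inr _ => True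
  | inr _, inl _ => False
  | inr u, inr v => mrlex u v
  end.

Definition gt_ht (K : fieldType) (n : nat) (M1 N1 M2 N2 : {cmonom 'I_n}) :
    {cmonom vars K M1 N1 M2 N2} -> {cmonom vars K M1 N1 M2 N2} -> Prop :=
  degrevlex (@gt_var K n M1 N1 M2 N2).

Arguments gt_ht K {n} M1 N1 M2 N2 _ _.

(* The codomain S[t,z] of the toric map, the variables t and z being indexed by
   [ord0] and [ord_max]. *)
Notation Stz K n := {malg {malg K[{cmonom 'I_n}]}[{cmonom 'I_2}]}.

Definition toric_image (K : fieldType) (n : nat) (M1 N1 M2 N2 : {cmonom 'I_n})
    (w : vars K M1 N1 M2 N2) : Stz K n :=
  match w with
  | inl u => << << gval u >> *g ucm (ord0 : 'I_2) >>
  | inr v => << << gval v >> *g ucm (ord_max : 'I_2) >>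
  end.

Definition toric_map (K : fieldType) (n : nat) (M1 N1 M2 N2 : {cmonom 'I_n})
    (f : {malg K[{cmonom vars K M1 N1 M2 N2}]}) : Stz K n :=
  mmap (fun c : K => (c%:MP)%:MP)
       (fun m : {cmonom vars K M1 N1 M2 N2} =>
          \prod_(w <- finsupp m) toric_image w ^+ m w) f.

Definition toric_ideal (K : fieldType) (n : nat)
    (M1 N1 M2 N2 : {cmonom 'I_n}) : set {malg K[{cmonom vars K M1 N1 M2 N2}]} :=
  [set f | toric_map f = 0].

Arguments toric_ideal K {n} M1 N1 M2 N2 _.

(* A pair [(p, q)] of monomials encodes the binomial p - q with p underlined. *)
Definition binomial_of (K : fieldType) (I : choiceType)
    (b : {cmonom I} * {cmonom I}) : {malg K[{cmonom I}]} :=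
  << b.1 >> - << b.2 >>.

Section Binomials.
Context (K : fieldType) (n : nat) (M1 N1 M2 N2 : {cmonom 'I_n}).

Let mon := {cmonom vars K M1 N1 M2 N2}.
Let T (u : gens K M1 N1) : mon := ucm (inl u : vars K M1 N1 M2 N2).
Let Z (v : gens K M2 N2) : mon := ucm (inr v : vars K M1 N1 M2 N2).

Definition G1 : set (mon * mon) :=
  [set b | exists u v u' v' : gens K M1 N1,
     [/\ mmul (gval u) (gval v) = mmul (gval u') (gval v'),
         rlex (gval u) (gval v'), rlex (gval v) (gval v') &
         b = (mmul (T u) (T v), mmul (T u') (T v'))]].

Definition G2 : set (mon * mon) :=
  [set b | exists u v u' v' : gens K M2 N2,
     [/\ mmul (gval u) (gval v) = mmul (gval u') (gval v'),
         mrlex u v', mrlex v v' &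
         b = (mmul (Z u) (Z v), mmul (Z u') (Z v'))]].

Definition G3 : set (mon * mon) :=
  [set b | exists (u u' : gens K M1 N1) (v v' : gens K M2 N2),
     [/\ mmul (gval u) (gval v) = mmul (gval u') (gval v'),
         mrlex v v' &
         b = (mmul (T u) (Z v), mmul (T u') (Z v'))]].

Definition Gall : set (mon * mon) := G1 `|` G2 `|` G3.

End Binomials.

Arguments Gall K {n} M1 N1 M2 N2 _.

(* Main.v *)
(* The toric ideal is spanned by differences of monomials with the same image
   under the toric map, so it suffices to show: if [m] and [m'] have the same
   image and [m] is larger than [m'], then an initial term of the family divides
   [m].  After cancelling common variables, the smallest variable [w] of [m'] is
   smaller than every variable of [m].

   Identify x_i x_j (i <= j) with the pair (i, j).  When [w] is a T-variable, or
   a Z-variable of the same type (old, from B(M_2), or new, from B(M_2, N_2) minus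
   B(M_2)) as some Z-variable of [m], two variables of [m] containing the indices
   of [w] can be exchanged against [w].  The remaining case, [w] old and all
   Z-variables of [m] new, is excluded by linear programming duality: assuming [m]
   irreducible, there is a weight on the indices 1..n for which every T-variable
   weighs at least alpha, every Z-variable at least beta and [w] more than beta,
   while these bounds are attained, up to a defect smaller than the surplus of
   [w], by all variables of [m].  As [m] and [m'] have the same degree in the T
   and in the Z and the same multiset of indices, this is impossible.  Because of
   d_1 <= d_2, no index exceeding b_2 of a T-variable of an irreducible [m] is
   larger than one of a Z-variable. *)

Require Import Defs.
From mathcomp Require Import all_boot all_order all_algebra.
From mathcomp Require Import classical_sets.
From mathcomp Require Import finmap boolp cardinality zify.
Set Implicit Arguments.
Unset Strict Implicit.
Unset Printing Implicit Defensive.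
Import GRing.Theory.

(** * Exchange of indices between quadratic monomials *)

Definition srt (x y : nat) : nat * nat := (minn x y, maxn x y).

(* A pair [(i, j)] with [i <= j] stands for x_i x_j.  Those in [inB a b c d] are
   the generators of B(x_a x_b, x_c x_d) when c < a <= b < d; such a generator is
   old, i.e. in B(x_a x_b), iff [j <= b]. *)
Definition inB (a b c d : nat) (u : nat * nat) : bool :=
  (u.1 <= u.2) && ((u.1 <= a) && (u.2 <= b) || (u.1 <= c) && (u.2 <= d)).

(** The left pair is the larger monomial. Since x_1 > ... > x_n, small indices make a monomial
    large, and the larger index of the pair decides first. *)
Definition rlex_pair (u v : nat * nat) : bool :=
  (u.2 < v.2) || (u.2 == v.2) && (u.1 < v.1).

Definition mrlex_pair (b : nat) (u v : nat * nat) : bool :=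
  (b < u.2) && (v.2 <= b) || ((u.2 <= b) == (v.2 <= b)) && rlex_pair u v.

Definition weight (F : nat -> nat) (l : seq (nat * nat)) : nat :=
  \sum_(u <- l) (F u.1 + F u.2).

(* Irreducibility is only needed for exchanges {e, f}, {g, h} -> {e, g}, {f, h};
   two positions [u], [v] of the list may hold equal pairs. *)
Definition irred (B : pred (nat * nat)) (gt : rel (nat * nat))
    (l : seq (nat * nat)) : Prop :=
  forall (u v : nat * nat) r e f g h, perm_eq l [:: u, v & r] ->
    u = srt e f -> v = srt g h -> B (srt e g) -> B (srt f h) ->
    gt u (srt f h) -> gt v (srt f h) -> False.

(** Only the Z-variable is compared, as in G3: every T-variable exceeds every Z-variable anyway. *)
Definition irred_mixed (B1 B2 : pred (nat * nat)) (gt : rel (nat * nat))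
    (lT lZ : seq (nat * nat)) : Prop :=
  forall (u v : nat * nat) e f g h, u \in lT -> v \in lZ ->
    u = srt e f -> v = srt g h -> B1 (srt e g) -> B2 (srt f h) ->
    gt v (srt f h) -> False.

Lemma inB_le a b c d u : inB a b c d u -> u.1 <= u.2.
Proof. by case/andP. Qed.

Lemma srt_id u : u.1 <= u.2 -> u = srt u.1 u.2.
Proof. by case: u => x y /= h; rewrite /srt; congr pair; lia. Qed.

Lemma srt_swap u : u.1 <= u.2 -> u = srt u.2 u.1.
Proof. by case: u => x y /= h; rewrite /srt; congr pair; lia. Qed.

Lemma weight_perm F l l' : perm_eq l l' -> weight F l = weight F l'.
Proof. by move=> h; apply: perm_big. Qed.

Lemma weight_cons F u l : weight F (u :: l) = F u.1 + F u.2 + weight F l.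
Proof. by rewrite /weight big_cons. Qed.

Lemma weight_nil F : weight F [::] = 0.
Proof. by rewrite /weight big_nil. Qed.

Lemma perm_rem (T : eqType) (x : T) s : x \in s -> exists r, perm_eq s (x :: r).
Proof. by move=> h; exists (rem x s); apply: perm_to_rem. Qed.

Lemma perm_two (T : eqType) (x y : T) s : x \in s -> y \in s -> x != y ->
  exists r, perm_eq s [:: x, y & r].
Proof.
move=> /perm_rem [r pr] hy ne; move: hy; rewrite (perm_mem pr) inE eq_sym (negbTE ne).
by case/perm_rem => r' pr'; exists r'; apply: perm_trans pr _; rewrite perm_cons.
Qed.

Lemma weight_occ p l : all (fun u => u.1 <= u.2) l ->
  0 < weight (fun i => nat_of_bool (i == p)) l -> exists u e, u \in l /\ u = srt p e.
Proof.
elim: l => [|u l IH] /=; first by rewrite weight_nil.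
case/andP=> hu hl; rewrite weight_cons.
case: (eqVneq u.1 p) => [e1 _|n1].
  exists u, u.2; rewrite mem_head -e1; split=> //; exact: srt_id.
case: (eqVneq u.2 p) => [e2 _|n2].
  exists u, u.1; rewrite mem_head -e2; split=> //; exact: srt_swap.
rewrite !add0n => /(IH hl) [v [e [hv ve]]].
by exists v, e; rewrite inE hv orbT.
Qed.

Definition occ (p : nat) (l : seq (nat * nat)) : nat :=
  weight (fun i => nat_of_bool (i == p)) l.

Lemma all_inB_le a b c d l : all (inB a b c d) l -> all (fun u => u.1 <= u.2) l.
Proof. by apply: sub_all => u /inB_le. Qed.

Ltac unfold_pairs := rewrite /mrlex_pair /rlex_pair /inB /srt /=.

Ltac solve_pairs := unfold_pairs => *; try congr pair; lia.

Section OneIdeal.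
Variables (a b c d : nat).
Hypotheses (hca : c < a) (hab : a <= b) (hbd : b < d).

(** Let w = (p, q). A pair of [l] containing q is (i, q) with i < p, as it exceeds [w]. Exchanging
    it with a pair {p, e} produces [w] and {i, e}, which stays in B because i < p. *)
Lemma irred_rlex_pair l w : all (inB a b c d) l -> irred (inB a b c d) rlex_pair l ->
  (forall x, (w.1 == x) + (w.2 == x) <= occ x l) -> inB a b c d w ->
  all (fun u => rlex_pair u w) l -> False.
Proof.
case: w => p q /= hB irr hw wB hall; have hpq : p <= q := inB_le wB.
have hle := all_inB_le hB.
have [|u [i [ul ui]]] := @weight_occ q l hle.
  by have := hw q; rewrite /occ; lia.
have [r pr] := perm_rem ul.
have hiq : i < p.
  by have := allP hall u ul; move: ui; clear -hpq; unfold_pairs => ->; unfold_pairs; lia.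
(* As i < p, the pair [u] uses up a copy of p only if p = q, and then [w] requires two copies. *)
have hr : 0 < weight (fun i => nat_of_bool (i == p)) r.
  have := hw p; rewrite /occ (weight_perm _ pr) weight_cons ui /=; lia.
have hler : all (fun u => u.1 <= u.2) r.
  by move: hle; rewrite (perm_all _ pr) => /andP [].
have [v [e [vr ve]]] := weight_occ hler hr.
have vl : v \in l by rewrite (perm_mem pr) inE vr orbT.
have [r' pr'] := perm_rem vr.
have pl : perm_eq l [:: u, v & r'].
  by apply: perm_trans pr _; rewrite perm_cons.
have := allP hall v vl; have := allP hall u ul.
have := allP hB v vl; have := allP hB u ul.
move=> Bu Bv ru rv.
have := irr u v r' i q e p pl.
move: Bu Bv ru rv; rewrite ui ve; clear -hca hab hbd hpq hiq wB.
move=> Bu Bv ru rv H; apply: H; move: Bu Bv ru rv wB; solve_pairs.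
Qed.

End OneIdeal.

Lemma weight_le (F : nat -> nat) l k :
  (forall u : nat * nat, u \in l -> F u.1 + F u.2 <= k) -> weight F l <= k * size l.
Proof.
elim: l => [|u l IH] h; first by rewrite weight_nil.
rewrite weight_cons /= mulnS leq_add ?h ?mem_head // IH // => v vl.
by rewrite h // inE vl orbT.
Qed.

Lemma weight_ge (F : nat -> nat) l k :
  (forall u : nat * nat, u \in l -> k <= F u.1 + F u.2) -> k * size l <= weight F l.
Proof.
elim: l => [|u l IH] h; first by rewrite weight_nil muln0.
rewrite weight_cons /= mulnS leq_add ?h ?mem_head // IH // => v vl.
by rewrite h // inE vl orbT.
Qed.

Lemma has_pair (P : pred (nat * nat)) l :
  has P l -> exists2 u : nat * nat, u \in l & P u.
Proof. by move/hasP. Qed.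

Lemma ex_min_max (l : seq (nat * nat)) : 0 < size l ->
  exists2 v : nat * nat, v \in l & forall z : nat * nat, z \in l -> v.2 <= z.2.
Proof.
elim: l => //= u [_ _|u' l /(_ isT) [v vl hv] _].
  by exists u; rewrite ?mem_head // => z; rewrite inE => /eqP ->.
have [h|h] := leqP u.2 v.2.
  exists u; first exact: mem_head.
  by move=> z; rewrite inE => /orP [/eqP -> //|/hv]; apply: leq_trans.
exists v; first by rewrite inE vl orbT.
by move=> z; rewrite inE => /orP [/eqP ->|/hv //]; apply: ltnW.
Qed.

Definition at_most (t i : nat) : nat := i <= t.

Section TwoIdeals.
Variables (a1 b1 c1 d1 a2 b2 c2 d2 : nat).
Hypotheses (hca1 : c1 < a1) (hab1 : a1 <= b1) (hbd1 : b1 < d1).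
Hypotheses (hca2 : c2 < a2) (hab2 : a2 <= b2) (hbd2 : b2 < d2).
Hypothesis hd : d1 <= d2.
Ltac keep_params := clear - hca1 hab1 hbd1 hca2 hab2 hbd2 hd.

Local Notation B1 := (inB a1 b1 c1 d1).
Local Notation B2 := (inB a2 b2 c2 d2).

(** * Exchanges against a smallest Z-variable *)

Section Exchange.
Variables (lT lZ : seq (nat * nat)) (w : nat * nat).
Hypotheses (hT : all B1 lT) (hZ : all B2 lZ) (hw : B2 w).
Hypothesis irrZ : irred B2 (mrlex_pair b2) lZ.
Hypothesis irrM : irred_mixed B1 B2 (mrlex_pair b2) lT lZ.
Hypothesis hall : forall v : nat * nat, v \in lZ -> mrlex_pair b2 v w.

Hypothesis occ_w : forall x, (w.1 == x) + (w.2 == x) <= occ x lT + occ x lZ.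

(** Here v.1 < w.1. Some variable other than [v] contains w.1; trading w.1 for v.1 turns [v] into
    [w], and the other variable only has an index lowered. *)
Lemma exchange_same_max (v : nat * nat) : v \in lZ -> v.2 = w.2 -> False.
Proof.
move=> vZ vw; have [r pr] := perm_rem vZ.
have Bv := allP hZ v vZ; have mv := hall vZ.
have vp : v.1 < w.1 by move: Bv hw mv vw; clear; unfold_pairs; lia.
have := occ_w w.1.
rewrite /occ (weight_perm _ pr) weight_cons eqxx /= => ho.
have {ho} : 0 < occ w.1 lT \/ 0 < occ w.1 r.
  move: ho; rewrite /occ vw (_ : (v.1 == w.1) = false); last by lia.
  by move: (weight _ lT) (weight _ r) => x y; lia.
case.
  case/(weight_occ (all_inB_le hT)) => u [e [uT ue]].
  have Bu := allP hT u uT.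
  apply: (@irrM u v e w.1 v.1 v.2 uT vZ); move: Bu Bv mv vp vw hw; rewrite ?ue;
    case: (v) (w) => [v1 v2] [p q] /=; clear; solve_pairs.
have hr : all (fun u => u.1 <= u.2) r.
  by move: (all_inB_le hZ); rewrite (perm_all _ pr) => /andP [].
case/(weight_occ hr) => z [e [zr ze]].
have zZ : z \in lZ by rewrite (perm_mem pr) inE zr orbT.
have [r' pr'] := perm_rem zr.
have Bz := allP hZ z zZ; have mz := hall zZ.
have pl : perm_eq lZ [:: v, z & r'].
  by apply: perm_trans pr _; rewrite perm_cons.
apply: (@irrZ v z r' v.1 v.2 e w.1 pl); move: Bz mz Bv mv vp vw hw; rewrite ?ze;
  case: (v) (w) => [v1 v2] [p q] /=; keep_params; solve_pairs.
Qed.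

(** A variable containing w.2 trades it for v.2. Since [v] and [w] have the same type, {v.1, w.2} is
    again a generator of that type, and it is smaller than [v]. *)
Lemma exchange_larger_max (v : nat * nat) : v \in lZ -> v.2 < w.2 ->
  (v.2 <= b2) = (w.2 <= b2) -> False.
Proof.
move=> vZ vw hb; have Bv := allP hZ v vZ; have mv := hall vZ.
have := occ_w w.2.
have H (z : nat * nat) : z \in lZ -> z.2 != w.2.
  by move=> zZ; apply/eqP => e; apply: (exchange_same_max zZ).
rewrite eqxx => ho.
have {ho} : 0 < occ w.2 lT \/ 0 < occ w.2 lZ by lia.
case.
  case/(weight_occ (all_inB_le hT)) => u [e [uT ue]].
  have Bu := allP hT u uT.
  apply: (@irrM u v e w.2 v.2 v.1 uT vZ); move: Bu Bv mv vw hb hw; rewrite ?ue;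
    case: (v) (w) => [v1 v2] [p q] /=; keep_params; solve_pairs.
case/(weight_occ (all_inB_le hZ)) => z [e [zZ ze]].
have nz : v != z.
  apply/eqP => vz; move: Bv vw; rewrite vz ze; clear; unfold_pairs; lia.
have [r' pl] := perm_two vZ zZ nz.
have Bz := allP hZ z zZ; have mz := hall zZ; have Hz := H z zZ.
apply: (@irrZ v z r' v.2 v.1 e w.2 pl); move: Hz Bz mz Bv mv vw hb hw; rewrite ?ze;
  case: (v) (w) => [v1 v2] [p q] /=; keep_params; solve_pairs.
Qed.

Lemma exchange_same_type (v : nat * nat) : v \in lZ -> (v.2 <= b2) = (w.2 <= b2) -> False.
Proof.
move=> vZ hb; have mv := hall vZ.
have [e|/negP ne] := boolP (v.2 == w.2); first exact: (exchange_same_max vZ (eqP e)).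
by apply: (exchange_larger_max vZ _ hb); move: mv hb ne; clear; unfold_pairs; lia.
Qed.

Lemma all_new (v : nat * nat) : v \in lZ -> (w.2 <= b2) && (b2 < v.2).
Proof.
move=> vZ; have mv := hall vZ; have := exchange_same_type vZ.
by move: mv; unfold_pairs; case: (v.2 <= b2) (w.2 <= b2) => [] [] //=; lia.
Qed.

End Exchange.

(** ** Excluding an old smallest variable by weights *)

(* The primed lists come from the smaller monomial, whose smallest variable is
   [w].  In the lemmas below [v0] has the least larger index among the
   Z-variables, and the weight of an index counts thresholds it does not exceed. *)
Section Certificates.
Variables (lT lZ lT' lZ' : seq (nat * nat)) (w : nat * nat).
Hypotheses (hT : all B1 lT) (hZ : all B2 lZ).
Hypotheses (hT' : all B1 lT') (hZ' : all B2 lZ').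
Hypotheses (wZ' : w \in lZ') (wM : w.2 <= b2).
Hypotheses (szT : size lT = size lT') (szZ : size lZ = size lZ').
Hypothesis same_weight : forall F,
  weight F lT + weight F lZ = weight F lT' + weight F lZ'.
Hypotheses (irrT : irred B1 rlex_pair lT) (irrZ : irred B2 (mrlex_pair b2) lZ).
Hypothesis irrM : irred_mixed B1 B2 (mrlex_pair b2) lT lZ.
Hypothesis irrS : forall u v : nat * nat, u \in lT -> v \in lZ -> B1 v -> B2 u ->
  mrlex_pair b2 v u -> False.
Hypothesis newZ : forall v : nat * nat, v \in lZ -> b2 < v.2.

(** Weak duality: the primed lists weigh at least alpha per T and beta per Z, plus more than eps
    gained from [w], while the unprimed lists exceed the bare bounds by at most eps. *)
Lemma certificate (F : nat -> nat) alpha beta eps :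
  (forall u, B1 u -> alpha <= F u.1 + F u.2) ->
  (forall v, B2 v -> beta <= F v.1 + F v.2) ->
  beta + eps < F w.1 + F w.2 ->
  weight F lT <= alpha * size lT + eps -> weight F lZ <= beta * size lZ -> False.
Proof.
move=> hF1 hF2 hFw leT leZ.
have geT : alpha * size lT' <= weight F lT'.
  by apply: weight_ge => u /(allP hT'); apply: hF1.
have [r pr] := perm_rem wZ'.
have geZ : beta * size r <= weight F r.
  apply: weight_ge => v vr; apply/hF2/(allP hZ').
  by rewrite (perm_mem pr) inE vr orbT.
have := same_weight F; rewrite (weight_perm _ pr) weight_cons.
move: leT leZ geT geZ; rewrite szT szZ (perm_size pr) /= mulnS.
move: (weight F lT) (weight F lZ) (weight F lT') (weight F r) (alpha * _) (beta * _).
move: hFw; move: (F w.1) (F w.2); clear; lia.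
Qed.

(** Otherwise u.2 and v.2 could be swapped: {v.1, u.2} is a generator because v.1 <= c2 and u.2 <=
    d1 <= d2. *)
Lemma big_index_le (u v : nat * nat) : u \in lT -> v \in lZ -> b2 < u.2 -> u.2 <= v.2.
Proof.
move=> uT vZ hu; rewrite leqNgt; apply/negP => lt.
have Bu := allP hT u uT; have Bv := allP hZ v vZ; have nv := newZ vZ.
apply: (@irrM u v u.1 u.2 v.2 v.1 uT vZ); move: Bu Bv hu lt nv;
  case: (u) (v) => [e f] [r s] /=; keep_params; solve_pairs.
Qed.

(** Trading x for v.2 would turn the new [v] into {x, v.1}, which is old and therefore smaller. *)
Lemma small_exchange (u v : nat * nat) x y : u \in lT -> v \in lZ -> u = srt x y ->
  x <= b2 -> B1 (srt y v.2) = false.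
Proof.
move=> uT vZ ue hx; apply/negP => By.
have Bv := allP hZ v vZ; have nv := newZ vZ.
apply: (@irrM u v y x v.2 v.1 uT vZ); move: Bv nv hx By ue;
  case: (u) (v) => [e f] [r s] /=; keep_params; unfold_pairs => *;
  (try match goal with H : _ = (_, _) |- _ => case: H => ? ? end);
  try congr pair; lia.
Qed.

(** Otherwise [u] is an old generator of the second ideal, and T_u Z_v reduces to T_v Z_u. This swap
    of whole pairs is the one use of [irrS]. *)
Lemma not_old (u v : nat * nat) : u \in lT -> v \in lZ -> B1 v -> u.2 <= b2 -> a2 < u.1.
Proof.
move=> uT vZ Bv hu; rewrite ltnNge; apply/negP => lt.
have Bu := allP hT u uT; have nv := newZ vZ.
apply: (irrS uT vZ Bv); move: Bu hu lt nv;
  case: (u) (v) => [e f] [r s] /=; keep_params; solve_pairs.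
Qed.

(** Otherwise swapping the first indices creates (v.1, z.2), smaller than both pairs. *)
Lemma sorted_new (v z : nat * nat) : v \in lZ -> z \in lZ -> v.2 < z.2 -> v.1 <= z.1.
Proof.
move=> vZ zZ lt; rewrite leqNgt; apply/negP => gt.
have Bv := allP hZ v vZ; have nv := newZ vZ.
have Bz := allP hZ z zZ; have nz := newZ zZ.
have ne : v != z by apply/eqP => e; move: lt; rewrite e ltnn.
have [r pr] := perm_two vZ zZ ne.
apply: (@irrZ v z r v.2 v.1 z.1 z.2 pr); move: Bv nv Bz nz lt gt;
  case: (v) (z) => [e f] [g h] /=; keep_params; solve_pairs.
Qed.

Lemma exchange_T (u z : nat * nat) e f g h : u \in lT -> z \in lT -> u != z ->
  u = srt e f -> z = srt g h -> B1 (srt e g) -> B1 (srt f h) ->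
  rlex_pair u (srt f h) -> rlex_pair z (srt f h) -> False.
Proof. by move=> uT zT ne; have [r pr] := perm_two uT zT ne; apply: irrT pr. Qed.

(** The first index of a generator is at most a1, respectively a2 <= b2, so every variable weighs at
    least 1, while [w] weighs 2. *)
Lemma no_old_threshold t (v0 : nat * nat) :
  v0 \in lZ -> (forall v : nat * nat, v \in lZ -> v0.2 <= v.2) ->
  t = maxn a1 b2 -> t < v0.2 -> (forall u : nat * nat, u \in lT -> t < u.2) -> False.
Proof.
move=> v0Z min_v0 tE lt_t hu.
apply: (@certificate (at_most t) 1 1 0); rewrite /at_most.
- move=> u; rewrite tE; keep_params; unfold_pairs; lia.
- move=> u; rewrite tE; keep_params; unfold_pairs; lia.
- by have := allP hZ' w wZ' => /=; rewrite tE; move: wM; keep_params; unfold_pairs; lia.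
- rewrite addn0; apply: weight_le => u uT /=; have := hu u uT; lia.
apply: weight_le => v vZ /=; have := min_v0 v vZ; lia.
Qed.

(** Below the threshold max(b2, d1) lie all indices of T-variables and both indices of [w], but only
    the first index of each Z-variable of [lZ]. *)
Lemma no_old_far (v0 : nat * nat) : v0 \in lZ ->
  (forall v : nat * nat, v \in lZ -> v0.2 <= v.2) ->
  maxn b2 d1 < v0.2 -> False.
Proof.
move=> v0Z min_v0 lt_t.
apply: (@certificate (at_most (maxn b2 d1)) 2 1 0); rewrite /at_most.
- move=> u; keep_params; unfold_pairs; lia.
- move=> u; keep_params; unfold_pairs; lia.
- by have := allP hZ' w wZ' => /=; move: wM; keep_params; unfold_pairs; lia.
- by rewrite addn0; apply: weight_le => u uT /=; lia.
apply: weight_le => v vZ /=; have := min_v0 v vZ; lia.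
Qed.

Lemma no_old_all_big : (forall u : nat * nat, u \in lT -> b2 < u.1) -> False.
Proof.
move=> hu.
apply: (@certificate (at_most b2) 0 1 0); rewrite /at_most //.
- move=> u; keep_params; unfold_pairs; lia.
- by have := allP hZ' w wZ' => /=; move: wM; keep_params; unfold_pairs; lia.
- rewrite addn0; apply: weight_le => u uT /=; have := hu u uT.
  have := allP hT u uT; keep_params; unfold_pairs; lia.
apply: weight_le => v vZ /=; have := newZ vZ; lia.
Qed.

(** As v0.2 <= b1, {x, v0.2} is a T-variable for every x <= a1. Unless a contradiction arises at
    once, this pushes the larger index of every T-variable above max(a1, b2), and one threshold
    suffices. *)
Lemma no_old_near (u0 v0 : nat * nat) :
  v0 \in lZ -> (forall v : nat * nat, v \in lZ -> v0.2 <= v.2) -> v0.2 <= b1 ->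
  u0 \in lT -> u0.1 <= b2 -> False.
Proof.
move=> v0Z min_v0 le_b1 u0T le_u0.
have nv0 := newZ v0Z.
have bigT (u : nat * nat) : u \in lT -> b2 < u.2 -> u.2 <= v0.2.
  by move=> uT; apply: big_index_le.
have exch (u : nat * nat) : u \in lT -> u.1 <= b2 ->
    B1 (srt u.2 v0.2) = false /\ (u.2 <= b2 -> B1 (srt u.1 v0.2) = false).
  move=> uT hu; have le_u := inB_le (allP hT u uT).
  split; first exact: (small_exchange uT v0Z (srt_id le_u) hu).
  by move=> hu2; apply: (small_exchange uT v0Z (srt_swap le_u) hu2).
(* If u.2 <= a1, then {u.2, v0.2} lies in B1; if u.2 <= b2, then {u.1, v0.2} does. *)
have smallT (u : nat * nat) : u \in lT -> u.1 <= b2 -> maxn a1 b2 < u.2.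
  move=> uT hu; have := exch u uT hu; have := allP hT u uT.
  have := bigT u uT; move: nv0 hu le_b1; case: (u) (v0) => [e f] [r s] /=.
  by keep_params; unfold_pairs; lia.
have [le_a1|lt_a1] := leqP v0.2 a1.
  have := smallT u0 u0T le_u0; have := bigT u0 u0T; move: nv0 le_a1.
  by keep_params; lia.
apply: (no_old_threshold v0Z min_v0 (erefl _)) => [|u uT]; first by lia.
have [le_u|lt_u] := leqP u.1 b2; first exact: smallT.
rewrite ltnNge; apply/negP => hu.
(* Now b2 < u.1 <= u.2 <= a1, so [u] and [u0] reduce to {u.1, u0.1} and {u.2, u0.2}, the latter
   smaller than both. *)
have ne : u != u0 by apply/eqP => e; move: lt_u; rewrite e; lia.
have := smallT u0 u0T le_u0; have := bigT u0 u0T.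
have := @exchange_T u u0 u.1 u.2 u0.1 u0.2 uT u0T ne.
have := allP hT u uT; have := allP hT u0 u0T.
move: nv0 le_u0 le_b1 lt_u hu; case: (u) (u0) (v0) => [e f] [g h] [r s] /=.
keep_params; unfold_pairs => ? ? ? ? ? ? ? H ? ?.
by apply: H; solve_pairs.
Qed.

(** Two thresholds are used: max(b1, b2) and a lower one, tau, chosen such that a T-variable with
    both indices at most max(b1, b2) has both above tau. Every T-variable of [lT] then weighs at
    most 2. *)
Lemma no_old_exchange (z v0 : nat * nat) :
  v0 \in lZ -> (forall v : nat * nat, v \in lZ -> v0.2 <= v.2) ->
  b1 < v0.2 <= d1 -> z \in lT -> z.2 <= b2 -> False.
Proof.
move=> v0Z min_v0 hs zT le_z.
have nv0 := newZ v0Z.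
have exch (u : nat * nat) : u \in lT -> u.2 <= b2 -> c1 < u.1.
  move=> uT h2; have le_u := inB_le (allP hT u uT).
  have := small_exchange uT v0Z (srt_swap le_u) h2; rewrite ltnNge => /negP H.
  apply/negP => hc; apply: H; move: hc h2 hs nv0 le_u.
  by case: (u) (v0) => [e f] [r s] /=; keep_params; unfold_pairs; lia.
(* The pair [z] extends the bound from u.2 <= b2 to u.2 <= max(b1, b2): if u.1 <= tau < z.1 and b2 <
   u.2, then [u] and [z] reduce to {u.1, z.2} and {z.1, u.2}. *)
have low tau (u : nat * nat) : c1 <= tau ->
    (forall y : nat * nat, y \in lT -> y.2 <= b2 -> tau < y.1) ->
    u \in lT -> u.2 <= maxn b1 b2 -> tau < u.1.
  move=> htau smallT uT hu; have [le_u|lt_u] := leqP u.2 b2; first exact: smallT.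
  have lt_z := smallT z zT le_z; rewrite ltnNge; apply/negP => le_tau.
  have ne : u != z by apply/eqP => e; move: lt_u; rewrite e ltnNge le_z.
  have := @exchange_T u z u.1 u.2 z.2 z.1 uT zT ne.
  have := allP hT u uT; have := allP hT z zT.
  move: le_z hu lt_u lt_z le_tau; case: (u) (z) => [e f] [g h] /=.
  keep_params; unfold_pairs => ? ? ? ? ? ? ? H.
  by apply: H; solve_pairs.
(* If some Z-variable also lies in B1, [not_old] allows tau = max(c1, a2), and beta is 2. Otherwise,
   by [sorted_new], all first indices of Z-variables exceed c1; then tau = c1 and beta is 1. *)
have [/has_pair [v1 v1Z /andP [v1c v1d]]|/hasPn noZ] :=
    boolP (has (fun v => (v.1 <= c1) && (v.2 <= d1)) lZ).
  have Bv1 : B1 v1.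
    move: v1c v1d (allP hZ v1 v1Z); case: (v1) => r s /=.
    by keep_params; unfold_pairs; lia.
  have smallT (u : nat * nat) : u \in lT -> u.2 <= b2 -> maxn c1 a2 < u.1.
    by move=> uT hu; rewrite gtn_max (exch u uT hu) (not_old uT v1Z Bv1 hu).
  apply: (@certificate (fun i => at_most (maxn c1 a2) i + at_most (maxn b1 b2) i) 2 2 0);
    rewrite /at_most.
  - move=> u; keep_params; unfold_pairs; lia.
  - move=> u; keep_params; unfold_pairs; lia.
  - by have := allP hZ' w wZ'; move: wM; keep_params; unfold_pairs; lia.
  - rewrite addn0; apply: weight_le => u uT /=.
    have := low (maxn c1 a2) u (leq_maxl _ _) smallT uT; have := allP hT u uT.
    by case: (u) => e f; keep_params; unfold_pairs; lia.
  apply: weight_le => v vZ /=; have := min_v0 v vZ; have := newZ vZ.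
  have := allP hZ v vZ; move: hs; case: (v) (v0) => [r s] [? ?].
  by keep_params; unfold_pairs; lia.
have gtZ (v : nat * nat) : v \in lZ -> c1 < v.1.
  move=> vZ; have := noZ v vZ; have := noZ v0 v0Z; have := sorted_new v0Z vZ.
  by move: hs; case: (v) (v0) => [? ?] [? ?]; keep_params => /=; lia.
apply: (@certificate (fun i => at_most c1 i + at_most (maxn b1 b2) i) 2 1 0);
  rewrite /at_most.
- move=> u; keep_params; unfold_pairs; lia.
- move=> u; keep_params; unfold_pairs; lia.
- by have := allP hZ' w wZ'; move: wM; keep_params; unfold_pairs; lia.
- rewrite addn0; apply: weight_le => u uT /=.
  have := low c1 u (leqnn _) exch uT; have := allP hT u uT.
  by case: (u) => e f; keep_params; unfold_pairs; lia.
apply: weight_le => v vZ /=; have := min_v0 v vZ; have := newZ vZ; have := gtZ v vZ.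
have := allP hZ v vZ; move: hs; case: (v) (v0) => [r s] [? ?].
by keep_params; unfold_pairs; lia.
Qed.

(** If all larger indices of T-variables exceed max(a1, b2), one threshold suffices. Otherwise b2 <
    a1, and the thresholds max(b2, c1) and b1 give both families the bound 2 and [w] the weight
    4. *)
Lemma no_old_parity (u0 v0 : nat * nat) :
  v0 \in lZ -> (forall v : nat * nat, v \in lZ -> v0.2 <= v.2) ->
  b1 < v0.2 <= d1 -> (forall u : nat * nat, u \in lT -> b2 < u.2) ->
  u0 \in lT -> u0.1 <= b2 -> False.
Proof.
move=> v0Z min_v0 hs bigT u0T le_u0.
have nv0 := newZ v0Z.
have [/has_pair [u1 u1T le_u1]|/hasPn h] :=
    boolP (has (fun u : nat * nat => u.2 <= maxn a1 b2) lT); last first.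
  apply: (no_old_threshold v0Z min_v0 (erefl _)) => [|u uT].
    by move: hs nv0; keep_params; lia.
  by rewrite ltnNge; apply: h.
have {}le_u1 : u1.2 <= a1 by move: le_u1 (bigT u1 u1T); keep_params; lia.
set k := maxn b2 c1; pose F i := at_most k i + at_most b1 i.
have lt_b2 : b2 < a1 by apply: leq_trans le_u1; apply: bigT.
have exch (u : nat * nat) : u \in lT -> u.1 <= b2 -> k < u.2.
  move=> uT h1; have le_u := inB_le (allP hT u uT).
  rewrite gtn_max bigT //= ltnNge.
  have := small_exchange uT v0Z (srt_id le_u) h1 => /negP H.
  apply/negP => hc; apply: H; move: hc h1 hs nv0 le_u.
  by case: (u) (v0) => [e f] [r s] /=; keep_params; unfold_pairs; lia.
(* One T-variable may exceed its bound by 1, which is harmless since [w] does so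
   by 2. *)
suff wT : weight F lT <= 2 * size lT + 1.
  apply: (@certificate F 2 2 1) => //.
  - move=> u; rewrite /F /k /at_most; keep_params; unfold_pairs; lia.
  - move=> u; rewrite /F /k /at_most; move: lt_b2; keep_params; unfold_pairs; lia.
  - have := allP hZ' w wZ'; move: wM lt_b2; rewrite /F /k /at_most.
    by keep_params; unfold_pairs; lia.
  apply: weight_le => v vZ /=; have := min_v0 v vZ; have := newZ vZ.
  have := allP hZ v vZ; rewrite /F /k /at_most; move: hs lt_b2.
  by case: (v) (v0) => [r s] [? ?]; keep_params; unfold_pairs; lia.
have tight (u : nat * nat) : u \in lT -> (u.2 <= b1 -> k < u.1) -> F u.1 + F u.2 <= 2.
  move=> uT; have := allP hT u uT; rewrite /F /k /at_most; move: lt_b2.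
  by case: (u) => e f; keep_params; unfold_pairs; lia.
have [/has_pair [z zT /andP [z1 z2]]|/hasPn noT] :=
    boolP (has (fun u : nat * nat => (u.1 <= b2) && (u.2 <= a1)) lT).
  (* Only this occurrence of [z] may weigh 3. Any other entry, possibly an equal pair at another
     position, with u.1 <= k and u.2 <= b1 would reduce with [z] to {z.1, u.1} and {z.2, u.2}. *)
  have kz := exch z zT z1.
  have [r pr] := perm_rem zT.
  rewrite (weight_perm _ pr) weight_cons (perm_size pr) /= mulnS.
  have leF : F z.1 + F z.2 <= 3.
    rewrite /F; move: kz z1 z2; rewrite /k /at_most; keep_params; lia.
  rewrite [X in _ <= X]addnAC leq_add //.
  apply: weight_le => u ur.
  have uT : u \in lT by rewrite (perm_mem pr) inE ur orbT.
  apply: tight => // hu; rewrite ltnNge; apply/negP => ku.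
  have [r' pr'] := perm_rem ur.
  have pl : perm_eq lT [:: z, u & r'].
    by apply: perm_trans pr _; rewrite perm_cons.
  have := @irrT z u r' z.1 z.2 u.1 u.2 pl; have := bigT u uT.
  have := allP hT u uT; have := allP hT z zT.
  move: hu ku kz z1 z2; rewrite /k; case: (u) (z) => [e f] [g h] /=.
  keep_params; unfold_pairs => ? ? ? ? ? ? ? ? H.
  by apply: H; solve_pairs.
(* In this case no defect occurs. Exchanges with [u1] force b1 < y.2 whenever y.1 <= b2; an exchange
   with [u0] then excludes the pairs with b2 < u.1 <= c1 and u.2 <= b1. *)
have gt_u1 : b2 < u1.1.
  by have := noT u1 u1T; rewrite le_u1 andbT -ltnNge.
have big_pair (y u : nat * nat) : y \in lT -> y.1 <= b2 -> u \in lT -> b2 < u.1 ->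
   B1 (srt y.2 u.2) -> u.1 < y.2 -> u.2 < y.2 -> False.
  move=> yT hy uT hu; have ne : y != u.
    by apply/eqP => e; move: hu; rewrite -e ltnNge hy.
  have := @exchange_T y u y.1 y.2 u.1 u.2 yT uT ne.
  have := allP hT u uT; have := allP hT y yT.
  move: hu hy; case: (u) (y) => [e f] [g h] /=.
  keep_params; unfold_pairs => ? ? ? ? H ? ? ?.
  by apply: H; solve_pairs.
have lt_b1 (y : nat * nat) : y \in lT -> y.1 <= b2 -> b1 < y.2.
  move=> yT hy; rewrite ltnNge; apply/negP => le_b1.
  have lt_y : a1 < y.2 by have := noT y yT; rewrite hy /= -ltnNge.
  apply: (big_pair y u1 yT hy u1T gt_u1); move: lt_y le_b1 le_u1 (allP hT u1 u1T);
    case: (y) (u1) => [g h] [e f] /=; keep_params; unfold_pairs; lia.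
rewrite -[X in X <= _]addn0 leq_add //.
apply: weight_le => u uT; apply: tight => // hu; rewrite ltnNge; apply/negP => ku.
have [le_u|lt_u] := leqP u.1 b2.
  by have := lt_b1 u uT le_u; rewrite ltnNge hu.
have lt_u0 := lt_b1 u0 u0T le_u0.
have ne : u0 != u by apply/eqP => e; move: lt_u; rewrite -e ltnNge le_u0.
have := @exchange_T u0 u u0.1 u0.2 u.2 u.1 u0T uT ne.
move: ku lt_u hu lt_u0 le_u0 (allP hT u uT) (allP hT u0 u0T).
rewrite /k; case: (u0) (u) => [g h] [e f] /=.
keep_params; unfold_pairs => ? ? ? ? ? ? ? H.
by apply: H; solve_pairs.
Qed.

(** The cases are: v0.2 beyond max(b2, d1); all T-variables with both indices above b2; v0.2 <= b1;
    and, for b1 < v0.2 <= d1, whether some T-variable has both indices at most b2. *)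
Lemma old_not_below_new : False.
Proof.
have szZ0 : 0 < size lZ by rewrite szZ; case: (lZ') wZ'.
have [v0 v0Z min_v0] := ex_min_max szZ0.
have nv0 := newZ v0Z.
have [far|near] := ltnP (maxn b2 d1) v0.2; first exact: (no_old_far v0Z min_v0).
have le_d1 : v0.2 <= d1 by move: near nv0; keep_params; lia.
have [/has_pair [u0 u0T le_u0]|/hasPn h] :=
    boolP (has (fun u : nat * nat => u.1 <= b2) lT); last first.
  by apply: no_old_all_big => u uT; rewrite ltnNge; apply: h.
have [le_b1|lt_b1] := leqP v0.2 b1; first exact: (no_old_near v0Z min_v0 le_b1 u0T).
have hs : b1 < v0.2 <= d1 by rewrite lt_b1.
have [/has_pair [z zT le_z]|/hasPn h] :=
    boolP (has (fun u : nat * nat => u.2 <= b2) lT).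
  exact: (no_old_exchange v0Z min_v0 hs zT).
apply: (no_old_parity v0Z min_v0 hs _ u0T le_u0) => u uT.
by rewrite ltnNge; apply: h.
Qed.

End Certificates.
End TwoIdeals.

(** * Generators of B(M, N) *)

Section Monomials.
Variable I : choiceType.
Implicit Types (m p q : {cmonom I}).

Lemma mmulE p q i : mmul p q i = (p i + q i)%N.
Proof. exact: cmM. Qed.

Lemma divcm_mmul p q : divcm (mmul p q) p = q.
Proof. by apply/eqP/cmP => i; rewrite divcmE mmulE addKn. Qed.

Lemma mmul_divcm p m : (forall i, (p i <= m i)%N) -> m = mmul p (divcm m p).
Proof. by move=> h; apply/eqP/cmP => i; rewrite mmulE divcmE subnKC. Qed.

Lemma mmul_inj p q q' : mmul p q = mmul p q' -> q = q'.
Proof. by move=> e; rewrite -(divcm_mmul p q) e divcm_mmul. Qed.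

End Monomials.

(** * Monomial ideals *)

Section Ideals.
Variables (K : fieldType) (I : choiceType).
Local Notation P := {malg K[{cmonom I}]}.
Local Open Scope ring_scope.
Local Open Scope classical_set_scope.

Lemma malgUM (R : comNzRingType) (J : choiceType) (a b : R) (x y : {cmonom J}) :
  << a *g x >> * << b *g y >> = << a * b *g mmul x y >> :> {malg R[{cmonom J}]}.
Proof. by rewrite malgM_def fgmulUU. Qed.

Lemma ideal_gen_ideal (A : set P) : is_ideal (ideal_gen A).
Proof.
split=> [J [] // | f g hf hg J hJ sAJ | r f hf J hJ sAJ].
  by case: (hJ) => _ hD _; apply: hD; [apply: hf | apply: hg].
by case: (hJ) => _ _ hM; apply: hM; apply: hf.
Qed.

Lemma ideal_gen_sub (A : set P) f : A f -> ideal_gen A f.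
Proof. by move=> Af J _; apply. Qed.

Lemma ideal_gen_monomials (A : set {cmonom I}) (f : P) :
  ideal_gen [set << m >> | m in A] f ->
  forall m, m \in msupp f -> exists p q : {cmonom _}, A p /\ m = mmul p q.
Proof.
(* The polynomials all of whose monomials are multiples of elements of A form an ideal containing
   the generators. *)
move=> hf; pose J : set P :=
  [set f | forall m, m \in msupp f -> exists p q : {cmonom _}, A p /\ m = mmul p q].
apply: (hf J) => [|_ [m Am <-] k]; last first.
  by rewrite msuppU1 in_fset1 => /eqP ->; exists m, mone; rewrite mulm1.
split=> [m | g h Jg Jh m | r g Jg m]; first by rewrite msupp0.
  by move/(fsubsetP (msuppD_le _ _)); rewrite inE => /orP [/Jg|/Jh].
move/msuppM_le => [p [q [_ /Jg [a [b [Aa ->]]] ->]]].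
by exists a, (mmul p b); split=> //; apply/eqP/cmP => i; rewrite !mmulE addnCA.
Qed.

Lemma ideal_gen_monomialP (A : set {cmonom I}) m :
  ideal_gen [set (<< m >> : P) | m in A] << m >> <->
  exists p q : {cmonom _}, A p /\ m = mmul p q.
Proof.
split=> [/ideal_gen_monomials|[p [q [Ap ->]]]]; first by apply; rewrite msuppU1 in_fset1.
rewrite (_ : << _ >> = << q >> * << p >>); last by rewrite malgUM mulr1 mulmC.
case: (ideal_gen_ideal [set (<< m >> : P) | m in A]) => _ _; apply.
by apply: ideal_gen_sub; exists p.
Qed.

End Ideals.

(** * Strongly stable ideals generated by quadrics *)

Section Borel.
Variables (K : fieldType) (n : nat).
Local Notation mon := {cmonom 'I_n}.
Local Notation P := {malg K[mon]}.
Local Open Scope ring_scope.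
Local Open Scope classical_set_scope.
Implicit Types (A : set mon) (S : pred (nat * nat)).

Definition qmon (x y : 'I_n) : mon := mmul (ucm x) (ucm y).

Definition quadrics S : set mon :=
  [set m | exists x y : 'I_n, S (srt x y) /\ m = qmon x y].

Lemma qmonC x y : qmon x y = qmon y x.
Proof. exact: mulmC. Qed.

Lemma qmonE x y (i : 'I_n) : qmon x y i = ((x == i) + (y == i))%N.
Proof. by rewrite mmulE !cmU. Qed.

Lemma mdeg_qmon x y : mdeg (qmon x y) = 2.
Proof. by rewrite /qmon mdegM !mdegU. Qed.

Lemma move_qmon x y z : divcm (mmul (ucm z) (qmon x y)) (ucm x) = qmon z y.
Proof. by apply/eqP/cmP => i; rewrite divcmE !mmulE !cmU; lia. Qed.

(** In a multiple p q of p in A, the move is made in the cofactor q if x_i divides q, and in p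
    otherwise. *)
Lemma strongly_stable_gen A :
  (forall m (i j : 'I_n), A m -> (0 < m i)%N -> (j < i)%N ->
     A (divcm (mmul (ucm j) m) (ucm i))) ->
  strongly_stable (ideal_gen [set (<< m >> : P) | m in A]).
Proof.
move=> stA; split; first by exists A.
move=> m i j /ideal_gen_monomialP [p [q [Ap me]]] mi ji; apply/ideal_gen_monomialP.
have [qi|qi] := posnP (q i); last first.
  exists p, (divcm (mmul (ucm j) q) (ucm i)); split=> //.
  apply/eqP/cmP => k; rewrite me !(divcmE, mmulE) !cmU.
  by case: (eqVneq i k) => [<-|_]; rewrite addnCA ?subn0 // addnBA // ltn_addl.
have pi : (0 < p i)%N by move: mi; rewrite me mmulE qi addn0.
exists (divcm (mmul (ucm j) p) (ucm i)), q; split; first exact: stA.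
apply/eqP/cmP => k; rewrite me !(divcmE, mmulE) !cmU.
by case: (eqVneq i k) => [<-|_]; rewrite addnA ?subn0 // addnBAC // ltn_addl.
Qed.

Lemma borel_monomialP (ms : seq mon) A :
  (forall m (i j : 'I_n), A m -> (0 < m i)%N -> (j < i)%N ->
     A (divcm (mmul (ucm j) m) (ucm i))) ->
  (forall m, m \in ms -> A m) ->
  (forall m, A m -> borel K ms << m >>) ->
  forall m, borel K ms << m >> <-> exists p q : {cmonom _}, A p /\ m = mmul p q.
Proof.
move=> stA msA Ams m; split.
  move/(_ _ (strongly_stable_gen stA)) => h; apply/(@ideal_gen_monomialP K); apply: h.
  by move=> k /msA Ak; apply: ideal_gen_sub; exists k.
move=> [p [q [Ap ->]]] J sJ hJ; case: (sJ) => [[B JE] _].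
have [_ _ idJ] := ideal_gen_ideal [set (<< m >> : P) | m in B].
rewrite (_ : << _ >> = << q >> * << p >>); last by rewrite malgUM mulr1 mulmC.
by rewrite JE; apply: idJ; rewrite -JE; apply: Ams.
Qed.

(** Distinct monomials of the same degree do not divide each other, so no element of A is
    redundant. *)
Lemma min_gensP (J : set P) A d :
  (forall m, J << m >> <-> exists p q : {cmonom _}, A p /\ m = mmul p q) ->
  (forall m, A m -> mdeg m = d) -> min_gens J = A.
Proof.
move=> JE dA; apply/seteqP; split=> m.
  case=> /JE [p [q [Ap me]]] minm.
  have Jp : J << p >> by apply/JE; exists p, mone; rewrite mulm1.
  by rewrite -(minm p q me Jp).
move=> Am; split; first by apply/JE; exists m, mone; rewrite mulm1.
move=> p q me /JE [p' [q' [Ap' pe]]].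
have := dA m Am; rewrite me pe !mdegM (dA _ Ap') => e.
have q1 : mdeg q == 0%N by lia.
by rewrite -pe; move: q1; rewrite mdeg_eq0 => /eqP ->; rewrite mulm1.
Qed.

Definition down_closed S := forall x y z, (z <= x)%N -> S (srt x y) -> S (srt z y).

Lemma quadrics_stable S : down_closed S ->
  forall m (i j : 'I_n), quadrics S m -> (0 < m i)%N -> (j < i)%N ->
    quadrics S (divcm (mmul (ucm j) m) (ucm i)).
Proof.
move=> dS m i j [x [y [Sxy ->]]]; rewrite qmonE => hi ji.
wlog xi : x y Sxy hi / x = i.
  move=> W; have [/eqP xi|nx] := boolP (x == i); first exact: W.
  rewrite qmonC; apply: W; rewrite 1?addnC //.
    by move: Sxy; rewrite /srt minnC maxnC.
  by move: hi; rewrite (negbTE nx); case: eqP.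
exists j, y; rewrite -xi move_qmon; split=> //.
by apply: dS Sxy; rewrite xi ltnW.
Qed.

Lemma strongly_stable_down (J : set P) (x y x' y' : 'I_n) :
  strongly_stable J -> (x' <= x)%N -> (y' <= y)%N ->
  J << qmon x y >> -> J << qmon x' y' >>.
Proof.
case=> _ stJ.
have down (u v u' : 'I_n) : (u' <= u)%N -> J << qmon u v >> -> J << qmon u' v >>.
  rewrite leq_eqVlt => /orP [/eqP /val_inj -> //|lt] Juv.
  by rewrite -(move_qmon u v u'); apply: stJ; rewrite // qmonE eqxx.
by move=> hx hy /(down _ _ _ hx); rewrite ![qmon x' _]qmonC; apply: down.
Qed.

End Borel.

(** * Generators as pairs of indices *)

Section Gens.
Variables (K : fieldType) (n : nat) (a b c d : 'I_n).
Hypotheses (hca : (c < a)%N) (hab : (a <= b)%N) (hbd : (b < d)%N).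
Local Open Scope classical_set_scope.
Let M : {cmonom 'I_n} := mmul (ucm a) (ucm b).
Let N : {cmonom 'I_n} := mmul (ucm c) (ucm d).

Definition inM (a b : nat) (u : nat * nat) : bool :=
  [&& u.1 <= u.2, u.1 <= a & u.2 <= b]%N.

Lemma borel1P m : (borel K [:: M] << m >>%R) <->
  exists p q : {cmonom _}, quadrics (inM a b) p /\ m = mmul p q.
Proof.
apply: borel_monomialP.
- by apply: quadrics_stable => x y z; rewrite /inM /srt /=; lia.
- move=> k; rewrite inE => /eqP ->; exists a, b; split=> //.
  by rewrite /inM /srt /=; lia.
move=> k [x [y [Sxy ->]]] J sJ /(_ M (mem_head _ _)) JM.
wlog xy : x y Sxy / (x <= y)%N.
  move=> W; case/orP: (leq_total x y) => h; first exact: W.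
  by rewrite qmonC; apply: W => //; rewrite /srt minnC maxnC.
by apply: strongly_stable_down JM => //; move: Sxy xy; rewrite /inM /srt /=; lia.
Qed.

Lemma borel2P m : (borel K [:: M; N] << m >>%R) <->
  exists p q : {cmonom _}, quadrics (inB a b c d) p /\ m = mmul p q.
Proof.
apply: borel_monomialP.
- by apply: quadrics_stable => x y z; rewrite /inB /srt /=; lia.
- move=> k; rewrite !inE => /orP [] /eqP ->; [exists a, b | exists c, d]; split=> //;
    by rewrite /inB /srt /=; lia.
move=> k [x [y [Sxy ->]]] J sJ hJ.
have JM : J << M >>%R by apply: hJ; rewrite inE eqxx.
have JN : J << N >>%R by apply: hJ; rewrite !inE eqxx orbT.
wlog xy : x y Sxy / (x <= y)%N.
  move=> W; case/orP: (leq_total x y) => h; first exact: W.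
  by rewrite qmonC; apply: W => //; rewrite /srt minnC maxnC.
have : ((x <= a) && (y <= b) || (x <= c) && (y <= d))%N.
  by move: Sxy xy; rewrite /inB /srt /=; lia.
case/orP=> /andP [hx hy]; first exact: strongly_stable_down JM.
exact: strongly_stable_down JN.
Qed.

Lemma BM_E : BM K M = quadrics (inM a b).
Proof.
by apply: (min_gensP (d := 2) borel1P) => m [x [y [_ ->]]]; rewrite mdeg_qmon.
Qed.

Lemma min_gens2_E : min_gens (borel K [:: M; N]) = quadrics (inB a b c d).
Proof.
by apply: (min_gensP (d := 2) borel2P) => m [x [y [_ ->]]]; rewrite mdeg_qmon.
Qed.

(** The entries are natural numbers to match the exchange lemmas; sorting them makes the pair
    unique. *)
Definition pair_of (m : {cmonom 'I_n}) (p : nat * nat) : Prop :=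
  [/\ (p.1 <= p.2)%N, (p.2 < n)%N &
      forall i : 'I_n, m i = ((p.1 == i :> nat) + (p.2 == i :> nat))%N].

Lemma pair_of_qmon x y : pair_of (qmon x y) (srt x y).
Proof.
split; rewrite /srt /=; [lia | by rewrite gtn_max !ltn_ord |].
move=> i; rewrite qmonE -!val_eqE /=; lia.
Qed.

Lemma pair_of_inj m p q : pair_of m p -> pair_of m q -> p = q.
Proof.
case: p q => [p1 p2] [q1 q2] [/= hp hpn mp] [/= hq hqn mq].
have e i : (i < n)%N -> ((p1 == i) + (p2 == i) = (q1 == i) + (q2 == i))%N.
  by move=> hi; rewrite -(mp (Ordinal hi)) -(mq (Ordinal hi)).
have hp1 : (p1 < n)%N by lia.
have e2 : p2 = q2 by have := e p2 hpn; have := e q2 hqn; move: hp hq; clear; lia.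
by congr pair => //; have := e p1 hp1; rewrite e2; clear; lia.
Qed.

Lemma pair_of_eq m m' p : pair_of m p -> pair_of m' p -> m = m'.
Proof. by move=> [_ _ mp] [_ _ mp']; apply/eqP/cmP => i; rewrite mp mp'. Qed.

Lemma pair_of_exists p : (p.1 <= p.2)%N -> (p.2 < n)%N ->
  exists x y : 'I_n, p = srt x y /\ pair_of (qmon x y) p.
Proof.
case: p => p1 p2 /= h12 h2; have h1 : (p1 < n)%N by lia.
exists (Ordinal h1), (Ordinal h2); have e : (p1, p2) = srt (Ordinal h1) (Ordinal h2).
  by rewrite /srt /=; congr pair; lia.
by rewrite e; split=> //; apply: pair_of_qmon.
Qed.

Lemma mdeg_pair_of m p : pair_of m p -> mdeg m = 2.
Proof.
move=> hm; case: (hm) => h1 h2 _.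
have [x [y [_ hp]]] := pair_of_exists h1 h2.
by rewrite (pair_of_eq hm hp) mdeg_qmon.
Qed.

Lemma quadrics_pair_of S m p : pair_of m p -> quadrics S m <-> S p.
Proof.
move=> hm; split=> [[x [y [Sxy me]]]|Sp].
  by rewrite (pair_of_inj hm (q := srt x y)) // me; apply: pair_of_qmon.
case: (hm) => h1 h2 _; have [x [y [pe hp]]] := pair_of_exists h1 h2.
by exists x, y; rewrite -pe; split=> //; apply: pair_of_eq hm hp.
Qed.

Lemma rlex_pair_of m m' p p' : pair_of m p -> pair_of m' p' ->
  rlex m m' <-> rlex_pair p p'.
Proof.
move=> hm hm'; rewrite /rlex /degrevlex (mdeg_pair_of hm) (mdeg_pair_of hm').
case: p p' hm hm' => [x y] [z t] [/= hxy hy mE] [/= hzt ht mE'].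
have hx : (x < n)%N by lia.
have hz : (z < n)%N by lia.
split=> [[//|[_ [i [lt_i eq_i]]]]|].
  move: lt_i; rewrite mE mE'.
  have e j : (i < j)%N -> (j < n)%N -> ((x == j) + (y == j) = (z == j) + (t == j))%N.
    by move=> ij hj; rewrite -(mE (Ordinal hj)) -(mE' (Ordinal hj)); apply: eq_i.
  move: (nat_of_ord i) e => k e lt_k; rewrite /rlex_pair /=.
  have le_k : (k <= t)%N by move: lt_k hzt; clear; lia.
  have le_y : (y <= t)%N.
    rewrite leqNgt; apply/negP => lt_y; have := e y (leq_ltn_trans le_k lt_y) hy.
    by move: lt_y hzt; clear; lia.
  have [/eqP yt|ne] := boolP (y == t); last by rewrite ltn_neqAle ne le_y.
  rewrite yt ltnn /=.
  rewrite ltnNge; apply/negP => le_z; have := e x ^~ hx.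
  by move: lt_k le_z hxy hx hz; rewrite yt; clear; lia.
rewrite /rlex_pair /= => h; right; split=> //.
(* The last variable whose exponents differ is x_z if the larger indices agree, and x_t
   otherwise. *)
have [e|ne] := eqVneq y t.
  exists (Ordinal hz); rewrite mE mE' /=; split; first by lia.
  by move=> j /= hj; rewrite mE mE'; lia.
exists (Ordinal ht); rewrite mE mE' /=; split; first by lia.
by move=> j /= hj; rewrite mE mE'; lia.
Qed.

Lemma BM_pair_of m p : pair_of m p -> BM K M m <-> inM a b p.
Proof. by move=> hm; rewrite BM_E; apply: quadrics_pair_of. Qed.

Lemma BN_pair_of m p : pair_of m p -> BN K M N m <-> inB a b c d p && ~~ inM a b p.
Proof.
move=> hm; rewrite /BN /= min_gens2_E.
have -> : borel K [:: M] << m >>%R <-> inM a b p.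
  rewrite borel1P -(quadrics_pair_of _ hm); split=> [[q [r [Sq me]]]|Sm].
    have dq : mdeg q = 2 by case: Sq => x [y [_ ->]]; rewrite mdeg_qmon.
    have := mdeg_pair_of hm; rewrite me mdegM dq => e.
    have r1 : mdeg r == 0%N by move: e; case: (mdeg r).
    by move: r1; rewrite mdeg_eq0 => /eqP ->; rewrite mulm1.
  by exists m, mone; rewrite mulm1.
rewrite (quadrics_pair_of _ hm); split=> [[-> /negP ->] //|/andP [-> /negP]] //.
Qed.

Lemma gens_pair_of (u : gens K M N) : exists p, pair_of (gval u) p /\ inB a b c d p.
Proof.
have : (BM K M `|` BN K M N)%classic (gval u) by apply/asboolP; exact: valP u.
move: (gval u) => m.
have Q S : quadrics S m -> exists p, pair_of m p /\ S p.
  by case=> x [y [Sxy ->]]; exists (srt x y); split=> //; apply: pair_of_qmon.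
case=> [|[]]; last by rewrite min_gens2_E => /Q.
rewrite BM_E => /Q [p [hp Mp]]; exists p; split=> //.
by move: Mp; rewrite /inM /inB; lia.
Qed.

Definition gpair (u : gens K M N) : nat * nat := projT1 (cid (gens_pair_of u)).

Lemma gpairP u : pair_of (gval u) (gpair u).
Proof. by rewrite /gpair; case: cid => p []. Qed.

Lemma gpair_inB u : inB a b c d (gpair u).
Proof. by rewrite /gpair; case: cid => p []. Qed.

Lemma gpairE u (i : 'I_n) :
  gval u i = (((gpair u).1 == i :> nat) + ((gpair u).2 == i :> nat))%N.
Proof. by have [_ _] := gpairP u. Qed.

Lemma gpair_inj : injective gpair.
Proof.
move=> u v e; apply: val_inj; apply: (pair_of_eq (gpairP u)).
by rewrite e; apply: gpairP.
Qed.

Lemma gpair_surj p : inB a b c d p -> exists u, gpair u = p.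
Proof.
move=> hp; have [h1 h2] : (p.1 <= p.2)%N /\ (p.2 < n)%N.
  by have := ltn_ord b; have := ltn_ord d; move: hp; rewrite /inB; lia.
have [x [y [pe hq]]] := pair_of_exists h1 h2.
have hm : `[< (BM K M `|` BN K M N)%classic (qmon x y) >].
  apply/asboolP; case: (boolP (inM a b p)) => hM; [left | right].
    exact/(BM_pair_of hq).
  by apply/(BN_pair_of hq); rewrite hp.
exists (exist (fun m => `[< (BM K M `|` BN K M N)%classic m >]) _ hm).
by apply: pair_of_inj (gpairP _) _; exact: hq.
Qed.

(** A pair with first index at most c < a and second at most b is old too, so the larger index alone
    tells old from new. *)
Lemma BM_gpair u : BM K M (gval u) <-> ((gpair u).2 <= b)%N.
Proof.
rewrite (BM_pair_of (gpairP u)); have := gpair_inB u.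
by rewrite /inM /inB; split; lia.
Qed.

Lemma BN_gpair u : BN K M N (gval u) <-> (b < (gpair u).2)%N.
Proof.
rewrite (BN_pair_of (gpairP u)); have := gpair_inB u.
by rewrite /inM /inB; split; lia.
Qed.

Lemma rlex_gpair u v : rlex (gval u) (gval v) <-> rlex_pair (gpair u) (gpair v).
Proof. exact: rlex_pair_of (gpairP u) (gpairP v). Qed.

Lemma mrlex_gpair u v : mrlex u v <-> mrlex_pair b (gpair u) (gpair v).
Proof.
have := BM_gpair u; have := BM_gpair v; have := BN_gpair u; have := BN_gpair v.
have := rlex_gpair u v; rewrite /mrlex_pair ltnNge ltnNge => rlP Nv Nu Mv Mu.
split=> [[[/Mu hu /Mv hv /rlP ->]|[/Nu hu /Mv ->]|[/Nu hu /Nv hv /rlP ->]]|].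
- by rewrite hu hv orbT.
- by rewrite hu.
- by rewrite (negbTE hu) (negbTE hv) orbT.
case/orP=> [/andP [/Nu hu /Mv hv]|/andP [/eqP e /rlP h]]; first by constructor 2.
case: (boolP ((gpair u).2 <= b)%N) => hu.
  by constructor 1; split=> //; [apply/Mu | apply/Mv; rewrite -e].
by constructor 3; split=> //; [apply/Nu | apply/Nv; rewrite -e].
Qed.

Lemma finite_gens : finite_set [set: gens K M N].
Proof.
have -> : [set: gens K M N] = (gpair @^-1` (`I_n `*` `I_n))%classic.
  apply/seteqP; split=> // u _ /=; have [h1 h2 _] := gpairP u.
  by split=> //=; apply: leq_ltn_trans h2.
apply: finite_preimage; first by move=> u v _ _; apply: gpair_inj.
by apply: finite_setX; apply: finite_II.
Qed.
End Gens.

(** * The toric map *)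

Section VariableList.
Variable I : choiceType.
Implicit Types (m p q : {cmonom I}) (s t : seq I).

Definition vlist m : seq I := flatten [seq nseq (m w) w | w <- finsupp m].

Lemma count_vlist w m : count_mem w (vlist m) = m w.
Proof.
rewrite /vlist count_flatten -map_comp.
rewrite (eq_map (g := fun x => (x == w) * m x)%N); last first.
  by move=> x /=; rewrite count_nseq.
rewrite sumnE big_map; case: (boolP (w \in finsupp m)) => hw; last first.
  rewrite big_seq big1 ?memNfinsupp //; first by move: hw; rewrite -cmE_eq0 => /eqP.
  by move=> x hx; case: eqVneq => // e; move: hw; rewrite -e hx.
rewrite (bigD1_seq w) //= eqxx mul1n big1 ?addn0 // => x /negbTE ->.
by rewrite mul0n.
Qed.

Lemma perm_count s t : (forall w, count_mem w s = count_mem w t) -> perm_eq s t.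
Proof. by move=> h; apply/allP => w _ /=; rewrite h. Qed.

Lemma vlist_mul p q : perm_eq (vlist (mmul p q)) (vlist p ++ vlist q).
Proof. by apply: perm_count => w; rewrite count_cat !count_vlist mmulE. Qed.

Lemma vlist_ucm i : perm_eq (vlist (ucm i)) [:: i].
Proof. by apply: perm_count => w; rewrite count_vlist cmU /= addn0. Qed.

Lemma mem_vlist w m : (w \in vlist m) = (0 < m w)%N.
Proof. by rewrite -has_pred1 has_count count_vlist. Qed.

Lemma prod_finsupp (R : comNzRingType) (f : I -> R) m :
  (\prod_(w <- finsupp m) f w ^+ m w = \prod_(w <- vlist m) f w)%R.
Proof.
rewrite /vlist big_flatten big_map; apply: eq_bigr => w _.
by rewrite big_nseq iter_mulr_1.
Qed.

End VariableList.

Lemma binomial_coef (K : fieldType) (I : choiceType) (p q k : {cmonom I}) :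
  (mcoeff k (binomial_of K (p, q)) = (p == k)%:R - (q == k)%:R)%R.
Proof. by rewrite /binomial_of /= mcoeffB; congr (_ - _)%R; apply mcoeffU1. Qed.
(** With c the indicator of a fibre of the toric map, this puts a binomial whose monomials have the
    same image into the kernel. *)
Lemma binomial_sum (K : fieldType) (I : choiceType) (p q : {cmonom I})
    (c : pred {cmonom I}) :
  c p = c q ->
  (\sum_(k <- msupp (binomial_of K (p, q)))
     mcoeff k (binomial_of K (p, q)) *+ c k = 0)%R.
Proof.
move=> e; have := binomial_coef K p q; move: (binomial_of K (p, q)) => g gE.
have sub : (msupp g `<=` [fset p; q])%fset.
  apply/fsubsetP => k.
  rewrite -mcoeff_neq0 gE in_fset2 ![k == _]eq_sym.
  by case: (p == k); case: (q == k); rewrite //= ?subrr ?eqxx.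
rewrite (big_fset_incl _ sub) /=; last first.
  by move=> k _ /mcoeff_outdom ->; rewrite mul0rn.
have [pq|ne] := eqVneq p q.
  by apply: big1_seq => k _; rewrite gE pq subrr mul0rn.
rewrite big_fsetU1 ?in_fset1 //= big_seq_fset1 !gE !eqxx e.
by rewrite eq_sym (negbTE ne) subr0 sub0r -mulrnDl subrr mul0rn.
Qed.

Lemma sum_collision (T : choiceType) (G : zmodType) (s : seq T) (c : T -> G)
    (Q : pred T) m :
  uniq s -> m \in s -> Q m -> c m != 0%R ->
  (\sum_(k <- s) c k *+ Q k = 0)%R ->
  exists k, [/\ k \in s, k != m & Q k].
Proof.
move=> us ms Qm cm; rewrite (bigD1_seq m) //= Qm mulr1n => h.
have [/hasP [k ks /andP [km Qk]]|/hasPn no] :=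
    boolP (has (fun k => (k != m) && Q k) s); first by exists k.
move: h; rewrite big_seq_cond big1 ?addr0; last first.
  by move=> k /andP [ks km]; have := no k ks; rewrite km /= => /negbTE ->.
by move=> c0; rewrite c0 eqxx in cm.
Qed.

Section Toric.
Variables (K : fieldType) (n : nat) (M1 N1 M2 N2 : {cmonom 'I_n}).
Local Notation X := (vars K M1 N1 M2 N2).
Local Notation mon := {cmonom X}.
Local Notation P := {malg K[mon]}.
Local Open Scope ring_scope.

Definition var_val (w : X) : {cmonom 'I_n} :=
  match w with inl u => gval u | inr v => gval v end.

Definition var_end (w : X) : 'I_2 :=
  match w with inl _ => ord0 | inr _ => ord_max end.

Definition val_of (m : mon) : {cmonom 'I_n} :=
  \big[mmul/mone]_(w <- vlist m) var_val w.

Definition end_of (m : mon) : {cmonom 'I_2} :=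
  \big[mmul/mone]_(w <- vlist m) ucm (var_end w).

Lemma val_of_mul p q : val_of (mmul p q) = mmul (val_of p) (val_of q).
Proof. by rewrite /val_of (perm_big _ (vlist_mul p q)) big_cat. Qed.

Lemma end_of_mul p q : end_of (mmul p q) = mmul (end_of p) (end_of q).
Proof. by rewrite /end_of (perm_big _ (vlist_mul p q)) big_cat. Qed.

Lemma val_of_ucm w : val_of (ucm w) = var_val w.
Proof. by rewrite /val_of (perm_big _ (vlist_ucm w)) big_seq1. Qed.

Lemma end_of_ucm w : end_of (ucm w) = ucm (var_end w).
Proof. by rewrite /end_of (perm_big _ (vlist_ucm w)) big_seq1. Qed.

Lemma tz_mul (c c' : K) (v v' : {cmonom 'I_n}) (e e' : {cmonom 'I_2}) :
  << << c *g v >> *g e >> * << << c' *g v' >> *g e' >> =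
    << << c * c' *g mmul v v' >> *g mmul e e' >> :> Stz K n.
Proof. by rewrite !malgUM. Qed.

Lemma tz_coef (c : K) (v v' : {cmonom 'I_n}) (e e' : {cmonom 'I_2}) :
  mcoeff v (mcoeff e (<< << c *g v' >> *g e' >> : Stz K n)) =
    c *+ ((e' == e) && (v' == v)).
Proof.
by rewrite mcoeffU; case: (e' == e); rewrite ?mulr1n ?mulr0n ?mcoeff0 ?mcoeffU.
Qed.

Lemma toric_imageE w :
  toric_image w = << << var_val w >> *g ucm (var_end w) >> :> Stz K n.
Proof. by case: w. Qed.

Lemma toric_image_prod (m : mon) :
  \prod_(w <- finsupp m) toric_image w ^+ m w =
    << << val_of m >> *g end_of m >> :> Stz K n.
Proof.
rewrite prod_finsupp /val_of /end_of; elim: (vlist m) => [|w s IH].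
  by rewrite !big_nil.
rewrite !big_cons IH toric_imageE.
rewrite tz_mul; move: (\big[_/_]_(_ <- _) var_val _) (\big[_/_]_(_ <- _) ucm _) => v e.
by rewrite mulr1; reflexivity.
Qed.

Lemma toric_map_coef (f : P) (v : {cmonom 'I_n}) (e : {cmonom 'I_2}) :
  (mcoeff v (mcoeff e (toric_map f)) =
   \sum_(k <- msupp f) mcoeff k f *+ ((end_of k == e) && (val_of k == v))).
Proof.
rewrite /toric_map mmapE !raddf_sum; apply: eq_bigr => k _.
rewrite toric_image_prod tz_mul !mul1m mulr1; exact: tz_coef.
Qed.

Lemma toric_ideal_coef (f : P) (v : {cmonom 'I_n}) (e : {cmonom 'I_2}) :
  toric_ideal K M1 N1 M2 N2 f ->
  \sum_(k <- msupp f) mcoeff k f *+ ((end_of k == e) && (val_of k == v)) = 0.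
Proof.
rewrite -toric_map_coef /toric_ideal /= => hf.
by rewrite hf !mcoeff0.
Qed.

(** The coefficients of f over the fibre of m sum to zero, so m is not alone in it. This replaces
    the spanning of the toric ideal by binomials. *)
Lemma toric_ideal_collision (f : P) (m : mon) : toric_ideal K M1 N1 M2 N2 f ->
  m \in msupp f ->
  exists m' : mon,
    [/\ m' \in msupp f, m' != m, end_of m' = end_of m & val_of m' = val_of m].
Proof.
move=> hf hm; have h := toric_ideal_coef (val_of m) (end_of m) hf.
have fm : mcoeff m f != 0 by rewrite mcoeff_neq0.
have [|k [hk km /andP [/eqP e /eqP v]]] := sum_collision (fset_uniq _) hm _ fm h.
  by rewrite !eqxx.
by exists k.
Qed.

Lemma toric_binomial (p q : mon) : end_of p = end_of q -> val_of p = val_of q ->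
  toric_ideal K M1 N1 M2 N2 (binomial_of K (p, q)).
Proof.
move=> e v; apply/malgP => i; apply/malgP => j.
rewrite toric_map_coef !mcoeff0.
apply: (@binomial_sum K _ p q (fun k => (end_of k == i) && (val_of k == j))).
by rewrite e v.
Qed.

End Toric.

(** * The initial ideal *)

Section Binomial.
Variables (I : choiceType) (gtv : I -> I -> Prop) (key : I -> nat).
Hypothesis gtvP : forall i j, gtv i j <-> (key i < key j)%N.

Lemma degrevlex_irr m : ~ degrevlex gtv m m.
Proof. by case=> [|[_ [i []]]]; rewrite ltnn. Qed.

(** The deciding variable is the smaller of z and t, that is, the one with the larger key. *)
Lemma degrevlex_pair (x y z t : I) : (key x < key t)%N -> (key y < key t)%N ->
  degrevlex gtv (mmul (ucm x) (ucm y)) (mmul (ucm z) (ucm t)).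
Proof.
move=> xt yt; right; split; first by rewrite !mdegM !mdegU.
have ne i j : (key i < key j)%N -> (i == j) = false.
  by move=> lt; apply/eqP => e; rewrite e ltnn in lt.
have [le|lt] := leqP (key z) (key t).
  exists t; rewrite !mmulE !cmU (ne _ _ xt) (ne _ _ yt) eqxx addn1.
  split=> // j /gtvP tj.
  have zj := leq_ltn_trans le tj.
  by rewrite !mmulE !cmU (ne _ _ (ltn_trans xt tj)) (ne _ _ (ltn_trans yt tj)) !ne.
have xz := ltn_trans xt lt; have yz := ltn_trans yt lt.
exists z; rewrite !mmulE !cmU (ne _ _ xz) (ne _ _ yz) eqxx.
split=> // j /gtvP zj; have tj := ltn_trans lt zj.
by rewrite !mmulE !cmU (ne _ _ (ltn_trans xz zj)) (ne _ _ (ltn_trans yz zj)) !ne.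
Qed.

Lemma is_initial_binomial (K : fieldType) (p q : {cmonom I}) :
  degrevlex gtv p q ->
  is_initial (degrevlex gtv) (binomial_of K (p, q)) p /\
  mcoeff p (binomial_of K (p, q)) = 1%R.
Proof.
move=> pq; have ne : (q == p) = false.
  by apply/eqP => e; move: pq; rewrite e => /degrevlex_irr.
have c1 : mcoeff p (binomial_of K (p, q)) = 1%R.
  by rewrite binomial_coef eqxx ne subr0.
split=> //; split; first by rewrite -mcoeff_neq0 c1 oner_neq0.
move=> m; rewrite -mcoeff_neq0 binomial_coef [m == p]eq_sym.
move=> + /negbTE mp; rewrite mp sub0r; have [<- //|_] := eqVneq q m.
by rewrite oppr0 eqxx.
Qed.

End Binomial.

(** * From monomials in R to lists of pairs *)

Section Pmap.
Variables (X : eqType) (f : X -> option (nat * nat)).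
Hypothesis f_inj : forall x y a, f x = Some a -> f y = Some a -> x = y.

Lemma count_pmap x a s : f x = Some a -> count_mem a (pmap f s) = count_mem x s.
Proof.
move=> fx; elim: s => //= y s <-.
have -> : (y == x) = (f y == Some a).
  by apply/eqP/eqP => [-> //|fy]; apply: f_inj fy fx.
by case: (f y).
Qed.

Lemma mem_pmapP a s : a \in pmap f s -> exists2 x, x \in s & f x = Some a.
Proof. by rewrite mem_pmap => /mapP [x xs ->]; exists x. Qed.

(** Multiplicities are kept, so the product of the two variables divides the monomial even when x =
    y. *)
Lemma pmap_two s u v r : perm_eq (pmap f s) [:: u, v & r] ->
  exists x y, [/\ f x = Some u, f y = Some v &
    forall z, (x == z) + (y == z) <= count_mem z s].
Proof.
move=> pr.
have [x xs fx] : exists2 x, x \in s & f x = Some u.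
  by apply: mem_pmapP; rewrite (perm_mem pr) mem_head.
have [y ys fy] : exists2 y, y \in s & f y = Some v.
  by apply: mem_pmapP; rewrite (perm_mem pr) !inE eqxx orbT.
exists x, y; split=> // z.
have H a : f z = Some a -> (u == a) + (v == a) <= count_mem z s.
  move=> fz; rewrite -(count_pmap s fz).
  by move/seq.permP: pr => ->; rewrite /= addnA leq_addr.
have [xz|] := eqVneq x z.
  have := H u; rewrite -xz fx eqxx => /(_ erefl).
  have [yx|//] := eqVneq y x; last by rewrite /=; case: (v == u) => /=; lia.
  by move: fy; rewrite yx fx => -[->]; rewrite eqxx.
have [<- _|//] := eqVneq y z.
by have := H v; case: eqVneq => [<-|_] //=; move=> _; rewrite -has_count has_pred1.
Qed.

End Pmap.

Lemma sum_index n (p : nat * nat) (F : nat -> nat) : p.1 < n -> p.2 < n ->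
  \sum_(i < n) ((p.1 == i) + (p.2 == i)) * F i = F p.1 + F p.2.
Proof.
have one k : k < n -> \sum_(i < n) (k == i) * F i = F k.
  move=> hk; rewrite (bigD1 (Ordinal hk)) //= eqxx mul1n big1 ?addn0 // => i ne.
  by case: eqP => // e; case/eqP: ne; apply: val_inj; rewrite /= e.
move=> h1 h2; rewrite -(one _ h1) -(one _ h2) -big_split.
by apply: eq_bigr => i _; rewrite mulnDl.
Qed.

Lemma big_mmulE (I : choiceType) (T : Type) (s : seq T) (F : T -> {cmonom I}) i :
  (\big[mmul/mone]_(w <- s) F w) i = \sum_(w <- s) F w i.
Proof.
elim: s => [|w s IH]; first by rewrite !big_nil cm1.
by rewrite !big_cons mmulE IH.
Qed.

(** * Reduction of the larger of two monomials with the same image *)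

Section Main.
Variables (K : fieldType) (n : nat) (a1 b1 c1 d1 a2 b2 c2 d2 : 'I_n).
Hypotheses (hca1 : c1 < a1) (hab1 : a1 <= b1) (hbd1 : b1 < d1).
Hypotheses (hca2 : c2 < a2) (hab2 : a2 <= b2) (hbd2 : b2 < d2).
Hypothesis hd : d1 <= d2.
Let M1 : {cmonom 'I_n} := mmul (ucm a1) (ucm b1).
Let N1 : {cmonom 'I_n} := mmul (ucm c1) (ucm d1).
Let M2 : {cmonom 'I_n} := mmul (ucm a2) (ucm b2).
Let N2 : {cmonom 'I_n} := mmul (ucm c2) (ucm d2).
Local Notation B1 := (inB a1 b1 c1 d1).
Local Notation B2 := (inB a2 b2 c2 d2).
Local Notation X := (vars K M1 N1 M2 N2).
Local Notation mon := {cmonom X}.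

Definition tpair (u : gens K M1 N1) : nat * nat := gpair hca1 hab1 hbd1 u.
Definition zpair (v : gens K M2 N2) : nat * nat := gpair hca2 hab2 hbd2 v.

(** Base n with the larger index as leading digit: for entries below n, comparing codes is
    [rlex_pair]. *)
Definition code (p : nat * nat) : nat := p.2 * n + p.1.

(* Larger variables get smaller keys. *)
Definition key (w : X) : nat :=
  match w with
  | inl u => code (tpair u)
  | inr v => ((zpair v).2 <= b2) * n ^ 2 + n ^ 2 + code (zpair v)
  end.

Lemma code_lt p q : p.1 < n -> q.1 < n -> (code p < code q) = rlex_pair p q.
Proof.
move=> hp hq; rewrite /code /rlex_pair; case: (ltngtP p.2 q.2) => [lt|lt|->] /=.
- by have := leq_mul2r n p.2.+1 q.2; rewrite lt orbT mulSn => h; lia.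
- by have := leq_mul2r n q.2.+1 p.2; rewrite lt orbT mulSn => h; lia.
by rewrite ltn_add2l.
Qed.

Lemma code_bound p : p.1 < n -> p.2 < n -> code p < n ^ 2.
Proof.
move=> h1 h2; have := leq_mul2r n p.2.+1 n; rewrite h2 orbT mulSn /code.
by rewrite expnS expn1 => h; lia.
Qed.

Lemma tpair_lt u : (tpair u).1 < n /\ (tpair u).2 < n.
Proof.
by have [h1 h2 _] := gpairP hca1 hab1 hbd1 u; split=> //; apply: leq_ltn_trans h2.
Qed.

Lemma zpair_lt v : (zpair v).1 < n /\ (zpair v).2 < n.
Proof.
by have [h1 h2 _] := gpairP hca2 hab2 hbd2 v; split=> //; apply: leq_ltn_trans h2.
Qed.

(** Codes are below n^2, so the keys form three consecutive blocks: T-variables, new Z-variables,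
    old Z-variables. *)
Lemma gt_varP (i j : X) : gt_var i j <-> key i < key j.
Proof.
case: i j => [u|v] [u'|v'] /=.
- rewrite code_lt; [|by case: (tpair_lt u)|by case: (tpair_lt u')].
  exact: rlex_gpair.
- have [h1 h2] := tpair_lt u; have := code_bound h1 h2.
  by split=> // _; lia.
- have [h1 h2] := tpair_lt u'; have := code_bound h1 h2.
  by split=> //; lia.
have [h1 h2] := zpair_lt v; have := code_bound h1 h2 => c.
have [h1' h2'] := zpair_lt v'; have := code_bound h1' h2' => c'.
rewrite (mrlex_gpair hca2 hab2 hbd2) -/(zpair v) -/(zpair v') /mrlex_pair -code_lt //.
move: c c'; rewrite (ltnNge b2).
move: (n ^ 2) (code _) (code _) => N x y.
by case: ((zpair v).2 <= b2); case: ((zpair v').2 <= b2) => /=; lia.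
Qed.

Lemma key_inj : injective key.
Proof.
have c_inj p q : p.1 < n -> q.1 < n -> code p = code q -> p = q.
  move=> hp hq e; have := code_lt hp hq; have := code_lt hq hp.
  rewrite e ltnn /rlex_pair; case: p q {hp hq e} => [x y] [z t] /= h1 h2.
  by congr pair; lia.
move=> [u|v] [u'|v'] /=.
- have [h1 _] := tpair_lt u; have [h1' _] := tpair_lt u'.
  by move/(c_inj _ _ h1 h1')/gpair_inj => ->.
- by have [h1 h2] := tpair_lt u; have := code_bound h1 h2; lia.
- by have [h1 h2] := tpair_lt u'; have := code_bound h1 h2; lia.
have [h1 h2] := zpair_lt v; have := code_bound h1 h2.
have [h1' h2'] := zpair_lt v'; have := code_bound h1' h2'.
move=> c' c e.
suff /(c_inj _ _ h1 h1')/gpair_inj -> : code (zpair v) = code (zpair v') by [].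
move: c c' e; move: (n ^ 2) (code _) (code _) => N x y.
by case: (_ <= b2); case: (_ <= b2) => /=; lia.
Qed.

Lemma initial_Gall b : Gall K M1 N1 M2 N2 b -> gt_ht K M1 N1 M2 N2 b.1 b.2.
Proof.
have G := degrevlex_pair gt_varP.
case=> [[|]|].
- by case=> u [v [u' [v' [_ h1 h2 ->]]]]; apply: G; apply/gt_varP.
- by case=> u [v [u' [v' [_ h1 h2 ->]]]]; apply: G; apply/gt_varP.
by case=> u [u' [v [v' [_ h ->]]]]; apply: G; apply/gt_varP.
Qed.

Lemma toric_binomial_pair (w1 w2 w3 w4 : X) :
  mmul (var_val w1) (var_val w2) = mmul (var_val w3) (var_val w4) ->
  var_end w1 = var_end w3 -> var_end w2 = var_end w4 ->
  toric_ideal K M1 N1 M2 N2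
    (binomial_of K (mmul (ucm w1) (ucm w2), mmul (ucm w3) (ucm w4))).
Proof.
move=> e e1 e2; apply: toric_binomial; last by rewrite !val_of_mul !val_of_ucm.
by rewrite !end_of_mul !end_of_ucm e1 e2.
Qed.

Lemma toric_Gall b : Gall K M1 N1 M2 N2 b ->
  toric_ideal K M1 N1 M2 N2 (binomial_of K b).
Proof.
case=> [[|]|].
- case=> u [v [u' [v' [e _ _ ->]]]].
  exact: (@toric_binomial_pair (inl u) (inl v) (inl u') (inl v')).
- case=> u [v [u' [v' [e _ _ ->]]]].
  exact: (@toric_binomial_pair (inr u) (inr v) (inr u') (inr v')).
case=> u [u' [v [v' [e _ ->]]]].
exact: (@toric_binomial_pair (inl u) (inr v) (inl u') (inr v')).
Qed.

Lemma finite_Gall : finite_set (Gall K M1 N1 M2 N2).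
Proof.
have f1 := finite_gens K hca1 hab1 hbd1; have f2 := finite_gens K hca2 hab2 hbd2.
rewrite !finite_setU; split; first split.
- apply: (sub_finite_set _ (finite_image
    (fun t => (mmul (ucm (inl t.1.1 : X)) (ucm (inl t.1.2 : X)),
               mmul (ucm (inl t.2.1 : X)) (ucm (inl t.2.2 : X))))
    (finite_setX (finite_setX f1 f1) (finite_setX f1 f1)))).
  by move=> b [u [v [u' [v' [_ _ _ ->]]]]]; exists ((u, v), (u', v')).
- apply: (sub_finite_set _ (finite_image
    (fun t => (mmul (ucm (inr t.1.1 : X)) (ucm (inr t.1.2 : X)),
               mmul (ucm (inr t.2.1 : X)) (ucm (inr t.2.2 : X))))
    (finite_setX (finite_setX f2 f2) (finite_setX f2 f2)))).
  by move=> b [u [v [u' [v' [_ _ _ ->]]]]]; exists ((u, v), (u', v')).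
apply: (sub_finite_set _ (finite_image
  (fun t => (mmul (ucm (inl t.1.1 : X)) (ucm (inr t.1.2 : X)),
             mmul (ucm (inl t.2.1 : X)) (ucm (inr t.2.2 : X))))
  (finite_setX (finite_setX f1 f2) (finite_setX f1 f2)))).
by move=> b [u [u' [v [v' [_ _ ->]]]]]; exists ((u, v), (u', v')).
Qed.

(* The exponent of x_i in the monomial encoded by [p]. *)
Definition idx (p : nat * nat) (i : nat) : nat := (p.1 == i) + (p.2 == i).

Lemma idx_srt x y i : idx (srt x y) i = (x == i) + (y == i).
Proof. by rewrite /idx /srt /=; case: leqP => // _; rewrite addnC. Qed.

Lemma tpairE u (i : 'I_n) : gval u i = idx (tpair u) i.
Proof. exact: gpairE. Qed.

Lemma zpairE v (i : 'I_n) : gval v i = idx (zpair v) i.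
Proof. exact: gpairE. Qed.

Lemma exists_G1 U V p q : B1 p -> B1 q ->
  (forall i, idx (tpair U) i + idx (tpair V) i = idx p i + idx q i) ->
  rlex_pair (tpair U) q -> rlex_pair (tpair V) q ->
  exists m, Gall K M1 N1 M2 N2 (mmul (ucm (inl U)) (ucm (inl V)), m).
Proof.
move=> /(gpair_surj K hca1 hab1 hbd1) [u pu].
move=> /(gpair_surj K hca1 hab1 hbd1) [v qv] e h1 h2.
exists (mmul (ucm (inl u)) (ucm (inl v))); left; left; exists U, V, u, v; split=> //.
- by apply/eqP/cmP => i; rewrite !mmulE !tpairE e -pu -qv.
- by apply/(rlex_gpair hca1 hab1 hbd1); rewrite qv.
by apply/(rlex_gpair hca1 hab1 hbd1); rewrite qv.
Qed.

Lemma exists_G2 U V p q : B2 p -> B2 q ->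
  (forall i, idx (zpair U) i + idx (zpair V) i = idx p i + idx q i) ->
  mrlex_pair b2 (zpair U) q -> mrlex_pair b2 (zpair V) q ->
  exists m, Gall K M1 N1 M2 N2 (mmul (ucm (inr U)) (ucm (inr V)), m).
Proof.
move=> /(gpair_surj K hca2 hab2 hbd2) [u pu].
move=> /(gpair_surj K hca2 hab2 hbd2) [v qv] e h1 h2.
exists (mmul (ucm (inr u)) (ucm (inr v))); left; right; exists U, V, u, v; split=> //.
- by apply/eqP/cmP => i; rewrite !mmulE !zpairE e -pu -qv.
- by apply/(mrlex_gpair hca2 hab2 hbd2); rewrite qv.
by apply/(mrlex_gpair hca2 hab2 hbd2); rewrite qv.
Qed.

Lemma exists_G3 U V p q : B1 p -> B2 q ->
  (forall i, idx (tpair U) i + idx (zpair V) i = idx p i + idx q i) ->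
  mrlex_pair b2 (zpair V) q ->
  exists m, Gall K M1 N1 M2 N2 (mmul (ucm (inl U)) (ucm (inr V)), m).
Proof.
move=> /(gpair_surj K hca1 hab1 hbd1) [u pu] /(gpair_surj K hca2 hab2 hbd2) [v qv] e h.
exists (mmul (ucm (inl u)) (ucm (inr v))); right; exists U, u, V, v; split=> //.
- apply/eqP/cmP => i; rewrite !mmulE (tpairE U) (tpairE u).
  by rewrite (zpairE V) (zpairE v) e -pu -qv.
by apply/(mrlex_gpair hca2 hab2 hbd2); rewrite qv.
Qed.

Definition tcode (w : X) : option (nat * nat) :=
  if w is inl u then Some (tpair u) else None.

Definition zcode (w : X) : option (nat * nat) :=
  if w is inr v then Some (zpair v) else None.

Definition tlist (s : seq X) := pmap tcode s.
Definition zlist (s : seq X) := pmap zcode s.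

Lemma tcode_inj x y a : tcode x = Some a -> tcode y = Some a -> x = y.
Proof. by case: x y => [u|u] [v|v] //= [<-] [/gpair_inj ->]. Qed.

Lemma zcode_inj x y a : zcode x = Some a -> zcode y = Some a -> x = y.
Proof. by case: x y => [u|u] [v|v] //= [<-] [/gpair_inj ->]. Qed.

Lemma all_tlist s : all B1 (tlist s).
Proof. by elim: s => //= -[u|v] s IH //=; rewrite gpair_inB. Qed.

Lemma all_zlist s : all B2 (zlist s).
Proof. by elim: s => //= -[u|v] s IH //=; rewrite gpair_inB. Qed.

Lemma size_tlist (m : mon) : size (tlist (vlist m)) = end_of m ord0.
Proof.
rewrite /end_of big_mmulE; elim: (vlist m) => [|[u|v] s IH]; first by rewrite big_nil.
  by rewrite big_cons cmU /= IH.
by rewrite big_cons cmU /= IH.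
Qed.

Lemma size_zlist (m : mon) : size (zlist (vlist m)) = end_of m ord_max.
Proof.
rewrite /end_of big_mmulE; elim: (vlist m) => [|[u|v] s IH]; first by rewrite big_nil.
  by rewrite big_cons cmU /= IH.
by rewrite big_cons cmU /= IH.
Qed.

Lemma mdeg_end_of (m : mon) : mdeg (end_of m) = mdeg m.
Proof.
rewrite /end_of /vlist mdeg_prod mdegE big_flatten big_map; apply: eq_bigr => w _.
by rewrite big_nseq mdegU; elim: (m w) => //= k ->.
Qed.

Lemma weight_val_of F (m : mon) :
  weight F (tlist (vlist m)) + weight F (zlist (vlist m)) =
  \sum_(i < n) val_of m i * F i.
Proof.
rewrite /val_of; elim: (vlist m) => [|w s IH].
  by rewrite !weight_nil big1 // => i _; rewrite big_nil cm1.
rewrite [RHS](eq_bigr (fun i : 'I_n => var_val w i * F i +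
  (\big[mmul/mone]_(x <- s) var_val x) i * F i)); last first.
  by move=> i _; rewrite big_cons mmulE mulnDl.
rewrite big_split /= -IH; case: w => [u|v] /=; rewrite weight_cons.
  have [h1 h2] := tpair_lt u; rewrite -(sum_index F h1 h2) -addnA; congr (_ + _).
  by apply: eq_bigr => i _; rewrite tpairE.
have [h1 h2] := zpair_lt v; rewrite -(sum_index F h1 h2) addnCA; congr (_ + _).
by apply: eq_bigr => i _; rewrite zpairE.
Qed.

Section Irreducible.
Variables (m p : mon).
Hypothesis le_pm : forall w, p w <= m w.
Hypothesis no_red : forall b, Gall K M1 N1 M2 N2 b -> forall r, m <> mmul b.1 r.

(** Irreducibility passes from m to its divisor p. *)
Lemma no_red_pair (x y : X) q : (forall w, (x == w) + (y == w) <= p w) ->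
  ~ Gall K M1 N1 M2 N2 (mmul (ucm x) (ucm y), q).
Proof.
move=> h /no_red /(_ (divcm m (mmul (ucm x) (ucm y)))); apply.
apply: mmul_divcm => w /=; rewrite mmulE !cmU.
exact: leq_trans (h w) (le_pm w).
Qed.

Lemma tlist_irred : irred B1 rlex_pair (tlist (vlist p)).
Proof.
move=> u v r e f g h pr ue ve Beg Bfh ru rv.
have [x [y [fx fy le_xy]]] := pmap_two tcode_inj pr.
case: x fx le_xy => [U|//] [Uu] le_xy; case: y fy le_xy => [V|//] [Vv] le_xy.
have [|||q Gq] := @exists_G1 U V _ _ Beg Bfh; rewrite ?Uu ?Vv //.
  by move=> i; rewrite ue ve !idx_srt; lia.
by apply: (no_red_pair _ Gq) => w; have := le_xy w; rewrite count_vlist.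
Qed.

Lemma zlist_irred : irred B2 (mrlex_pair b2) (zlist (vlist p)).
Proof.
move=> u v r e f g h pr ue ve Beg Bfh ru rv.
have [x [y [fx fy le_xy]]] := pmap_two zcode_inj pr.
case: x fx le_xy => [//|U] [Uu] le_xy; case: y fy le_xy => [//|V] [Vv] le_xy.
have [|||q Gq] := @exists_G2 U V _ _ Beg Bfh; rewrite ?Uu ?Vv //.
  by move=> i; rewrite ue ve !idx_srt; lia.
by apply: (no_red_pair _ Gq) => w; have := le_xy w; rewrite count_vlist.
Qed.

Lemma mixed_irred u v p' q' : u \in tlist (vlist p) -> v \in zlist (vlist p) ->
  B1 p' -> B2 q' -> (forall i, idx u i + idx v i = idx p' i + idx q' i) ->
  mrlex_pair b2 v q' -> False.
Proof.
move=> /mem_pmapP [[U|//] Us [<-]] /mem_pmapP [[//|V] Vs [<-]] Bp Bq e h.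
have [q Gq] := exists_G3 Bp Bq e h; apply: (no_red_pair _ Gq) => w.
move: Us Vs; rewrite !mem_vlist => hU hV.
have [<-|_] := eqVneq (inl U) w; first by rewrite addn0.
by have [<-|_] := eqVneq (inr V) w.
Qed.

End Irreducible.

Lemma mem_tlist U s : inl U \in s -> tpair U \in tlist s.
Proof. by move=> Us; rewrite mem_pmap; apply/mapP; exists (inl U). Qed.

Lemma mem_zlist V s : inr V \in s -> zpair V \in zlist s.
Proof. by move=> Vs; rewrite mem_pmap; apply/mapP; exists (inr V). Qed.

Lemma weight_mem F (w : nat * nat) l : w \in l -> F w.1 + F w.2 <= weight F l.
Proof. by move=> /perm_rem [r pr]; rewrite (weight_perm _ pr) weight_cons leq_addr. Qed.

Lemma reducible (m m' : mon) : gt_ht K M1 N1 M2 N2 m m' ->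
  end_of m = end_of m' -> val_of m = val_of m' ->
  exists b r, Gall K M1 N1 M2 N2 b /\ m = mmul b.1 r.
Proof.
move=> gt e_end e_val; apply: contrapT => no.
have no_red b : Gall K M1 N1 M2 N2 b -> forall r, m <> mmul b.1 r.
  by move=> Gb r me; apply: no; exists b, r.
case: gt => [|[_ [w0 [lt_w0 eq_above]]]].
  by rewrite -!mdeg_end_of e_end ltnn.
(* Exponents are subtracted with truncation at 0, so c is the gcd of m and m', and p, q are the
   coprime cofactors. *)
pose p : mon := divcm m m'; pose q : mon := divcm m' m; pose c : mon := divcm m p.
have mE : m = mmul p c.
  by apply/eqP/cmP => w; rewrite mmulE !divcmE subnKC // leq_subr.
have mE' : m' = mmul q c.
  by apply/eqP/cmP => w; rewrite mmulE !divcmE; lia.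
have end_pq : end_of p = end_of q.
  by move: e_end; rewrite mE mE' !end_of_mul ![mmul _ (end_of c)]mulmC => /mmul_inj.
have val_pq : val_of p = val_of q.
  by move: e_val; rewrite mE mE' !val_of_mul ![mmul _ (val_of c)]mulmC => /mmul_inj.
have le_pm w : p w <= m w by rewrite divcmE leq_subr.
have szT : size (tlist (vlist p)) = size (tlist (vlist q)).
  by rewrite !size_tlist end_pq.
have szZ : size (zlist (vlist p)) = size (zlist (vlist q)).
  by rewrite !size_zlist end_pq.
have same_weight F : weight F (tlist (vlist p)) + weight F (zlist (vlist p)) =
    weight F (tlist (vlist q)) + weight F (zlist (vlist q)).
  by rewrite !weight_val_of val_pq.
(* Below [w0] the exponents of m and m' agree, and at [w0] that of m' is larger, so p has no
   variable there. *)
have above x : x \in vlist p -> gt_var x w0.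
  rewrite mem_vlist divcmE subn_gt0 => lt_x; apply/gt_varP.
  case: ltngtP => // [/gt_varP /eq_above e|/key_inj e].
    by rewrite e ltnn in lt_x.
  by move: lt_x; rewrite e ltnNge (ltnW lt_w0).
have w0q : w0 \in vlist q by rewrite mem_vlist divcmE subn_gt0.
have irrT := tlist_irred le_pm no_red.
have irrZ := zlist_irred le_pm no_red.
case: w0 above w0q {lt_w0 eq_above} => [W|W] above w0q.
  have noZ : zlist (vlist p) = [::].
    case E : (zlist (vlist p)) => [//|v l].
    have : v \in zlist (vlist p) by rewrite E mem_head.
    by move=> /mem_pmapP [[//|V] /above].
  apply: (irred_rlex_pair hca1 hab1 hbd1 (w := tpair W) (all_tlist _) irrT).
  - move=> x; have := same_weight (fun i => nat_of_bool (i == x)).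
    rewrite noZ weight_nil addn0 /occ => ->; apply: leq_trans (leq_addr _ _).
    exact: (weight_mem (fun i => nat_of_bool (i == x)) (mem_tlist w0q)).
  - exact: gpair_inB.
  apply/allP => u /mem_pmapP [[U|//] /above gtU [<-]].
  exact/(rlex_gpair hca1 hab1 hbd1).
have irrM : irred_mixed B1 B2 (mrlex_pair b2) (tlist (vlist p)) (zlist (vlist p)).
  move=> u v e f g h uT vZ ue ve Beg Bfh; apply: (mixed_irred le_pm no_red uT vZ Beg Bfh).
  by move=> i; rewrite ue ve !idx_srt; lia.
have above_W v : v \in zlist (vlist p) -> mrlex_pair b2 v (zpair W).
  move=> /mem_pmapP [[//|V] /above gtV [<-]].
  exact/(mrlex_gpair hca2 hab2 hbd2).
have WZ := mem_zlist w0q.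
have new : forall v, v \in zlist (vlist p) -> ((zpair W).2 <= b2) && (b2 < v.2).
  apply: (all_new hca1 hab1 hbd1 hca2 hab2 hbd2 hd (all_tlist _) (all_zlist _) _
    irrZ irrM above_W); first exact: gpair_inB.
  move=> x; rewrite /occ same_weight; apply: leq_trans (leq_addl _ _).
  exact: (weight_mem (fun i => nat_of_bool (i == x)) WZ).
(* Since q contains the Z-variable W and p has as many Z-variables as q, [new] is not vacuous. *)
have W_old : (zpair W).2 <= b2.
  case E : (zlist (vlist p)) szZ => [|v l] /=.
    by move/esym/size0nil => E'; rewrite E' in WZ.
  by have := new v; rewrite E mem_head => /(_ isT) /andP [].
apply: (old_not_below_new hca1 hab1 hbd1 hca2 hab2 hbd2 hd (all_tlist (vlist p))
  (all_zlist (vlist p)) (all_tlist (vlist q)) (all_zlist (vlist q)) WZ W_old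
  szT szZ same_weight irrT irrZ irrM).
- move=> u v uT vZ Bv Bu; apply: (mixed_irred le_pm no_red uT vZ Bv Bu).
  by move=> i; rewrite addnC.
by move=> v /new /andP [].
Qed.

Lemma initial_reducible f m : toric_ideal K M1 N1 M2 N2 f ->
  is_initial (gt_ht K M1 N1 M2 N2) f m ->
  exists b r, Gall K M1 N1 M2 N2 b /\ m = mmul b.1 r.
Proof.
move=> hf [mf max_m].
have [m' [m'f ne e_end e_val]] := toric_ideal_collision hf mf.
exact: reducible (max_m m' m'f ne) (esym e_end) (esym e_val).
Qed.

Lemma Gall_initial b : Gall K M1 N1 M2 N2 b ->
  is_initial (gt_ht K M1 N1 M2 N2) (binomial_of K b) b.1 /\
  mcoeff b.1 (binomial_of K b) = 1%R.
Proof.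
move=> Gb; have := is_initial_binomial K (initial_Gall Gb).
by rewrite -surjective_pairing.
Qed.

Lemma groebner_Gall : groebner_basis (gt_ht K M1 N1 M2 N2)
  [set binomial_of K b | b in Gall K M1 N1 M2 N2]%classic
  (toric_ideal K M1 N1 M2 N2).
Proof.
split; first exact: finite_image finite_Gall.
  by move=> _ [b Gb <-]; apply: toric_Gall.
apply/seteqP; split=> f hf J idJ sJ; apply: hf => // h.
  move=> [g [m [[b Gb <-] ini ->]]]; apply: sJ; exists (binomial_of K b), m.
  by split=> //; apply: toric_Gall.
move=> [g [m [hg ini ->]]].
have [b [r [Gb me]]] := initial_reducible hg ini.
have [inib cb] := Gall_initial Gb.
have : J << b.1 >>%R.
  apply: sJ; exists (binomial_of K b), b.1; split; [by exists b | exact: inib |].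
  by rewrite cb; reflexivity.
(* The initial term of the binomial is monic, so the cofactor carries the whole coefficient of m in
   g. *)
case: idJ => _ _ idM /(idM << mcoeff m g *g r >>%R).
by rewrite malgUM mulr1 mulmC -me.
Qed.
End Main.

Theorem theorem6p11 (K : fieldType) (n : nat)
    (a1 b1 c1 d1 a2 b2 c2 d2 : 'I_n)
    (hca1 : (c1 < a1)%N) (hab1 : (a1 <= b1)%N) (hbd1 : (b1 < d1)%N)
    (hca2 : (c2 < a2)%N) (hab2 : (a2 <= b2)%N) (hbd2 : (b2 < d2)%N)
    (hd : (d1 <= d2)%N) :
  let M1 : {cmonom 'I_n} := mmul (ucm a1) (ucm b1) in
  let N1 : {cmonom 'I_n} := mmul (ucm c1) (ucm d1) in
  let M2 : {cmonom 'I_n} := mmul (ucm a2) (ucm b2) in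
  let N2 : {cmonom 'I_n} := mmul (ucm c2) (ucm d2) in
  groebner_basis (gt_ht K M1 N1 M2 N2)
    [set binomial_of K b | b in Gall K M1 N1 M2 N2]%classic
    (toric_ideal K M1 N1 M2 N2)
  /\ (forall b, Gall K M1 N1 M2 N2 b ->
        is_initial (gt_ht K M1 N1 M2 N2) (binomial_of K b) b.1).
Proof.
move=> M1 N1 M2 N2; split; first exact: groebner_Gall.
by move=> b Gb; have [] := Gall_initial hca1 hab1 hbd1 hca2 hab2 hbd2 hd Gb.
Qed.
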